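(* Let $\mathcal{E}$ be any smooth charted 2-vector bundle of rank $n$ over $M$. After possibly replacing $\mathcal{E}$ by an elementary refinement, $\mathcal{E}$ has a connective structure, and such a choice is a contractible choice (i.e. the space of connective structures on the resulting bundle is contractible).
   Context: Categories. $\mathcal{V}$ has objects $\mathbb{C}^n$ ($n\ge0$) and morphisms $\operatorname{Aut}(\mathbb{C}^n)=\mathrm{Gl}_n(\mathbb{C})$. It is bipermutative under block sum $\oplus$ and tensor product $\otimes$ (lexicographically ordered bases), with permutation matrices as coherence isomorphisms. $M_n(\mathcal{V})$ is the monoidal category of $n\times n$ matrices of objects (morphisms) of $\mathcal{V}$ with product $(E\cdot F)_{ik}=\bigoplus_jE_{ij}\otimes F_{jk}$ and associator given entrywise by the canonical coherence isomorphism of $\mathcal{V}$. $\mathrm{Gl}_n(\mathcal{V})\subset M_n(\mathcal{V})$ is the full monoidal subcategory of objects $E$ with $\det(\dim E_{ij})\in\{1,-1\}$. Bundles. $M$ is a smooth paracompact manifold with smooth partitions of unity. An ordered open cover $(\mathcal{U},\mathcal{J})$ is an open cover $\{U_\alpha\}_{\alpha\in\mathcal{J}}$ indexed by a partially ordered set such that every finite set of indices with non-empty intersection $U_{\alpha_0\cdots\alpha_p}=U_{\alpha_0}\cap\dots\cap U_{\alpha_p}$ is totally ordered. A smooth charted 2-vector bundle $\mathcal{E}$ of rank $n$ over $M$ consists of an ordered open cover together with the following data. (1) For $\alpha<\beta$, objects $E^{\alpha\beta}$ of $\mathrm{Gl}_n(\mathcal{V})$ with $E^{\alpha\beta}\cdot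 E^{\beta\gamma}=E^{\alpha\gamma}$ as objects for $\alpha<\beta<\gamma$. (2) For $\alpha<\beta<\gamma$, smooth coherency maps $\phi^{\alpha\beta\gamma}:U_{\alpha\beta\gamma}\to\operatorname{Mor}(E^{\alpha\beta}\cdot E^{\beta\gamma},E^{\alpha\gamma})$. (3) At every point of $U_{\alpha\beta\gamma\delta}$: $\phi^{\alpha\beta\delta}\circ(\mathrm{id}\cdot\phi^{\beta\gamma\delta})=\phi^{\alpha\gamma\delta}\circ(\phi^{\alpha\beta\gamma}\cdot\mathrm{id})\circ c^{\alpha\beta\gamma\delta}$, with $c^{\alpha\beta\gamma\delta}:E^{\alpha\beta}\cdot(E^{\beta\gamma}\cdot E^{\gamma\delta})\to(E^{\alpha\beta}\cdot E^{\beta\gamma})\cdot E^{\gamma\delta}$ the associator. An elementary refinement of $\mathcal{E}$ is obtained from an ordered open cover $(\mathcal{U}',\mathcal{J}')$ and an order-preserving carrier function $\kappa:\mathcal{J}'\to\mathcal{J}$ with $U'_\alpha\subset U_{\kappa(\alpha)}$, by restricting the data: $E'^{\alpha\beta}=E^{\kappa(\alpha)\kappa(\beta)}$ and $\phi'^{\alpha\beta\gamma}=\phi^{\kappa(\alpha)\kappa(\beta)\kappa(\gamma)}|_{U'_{\alpha\beta\gamma}}$ (with the unit matrix and identity coherency maps when indices coincide). Connective structures. A connective structure $\nabla$ on $\mathcal{E}$ is, for each $\alpha<\beta$, an $n\times n$ matrix $\nabla^{\alpha\beta}$ of smooth connections, the $(i,j)$ entry being a connection on the trivial vector bundle $U_{\alpha\beta}\times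 E^{\alpha\beta}_{ij}$, such that for all $\alpha<\beta<\gamma$, over $U_{\alpha\beta\gamma}$, $$(\phi^{\alpha\beta\gamma})^*\nabla^{\alpha\gamma}=\nabla^{\alpha\beta}\cdot\nabla^{\beta\gamma}.$$ Here $(\nabla^{\alpha\beta}\cdot\nabla^{\beta\gamma})_{ik}=\bigoplus_j\nabla^{\alpha\beta}_{ij}\otimes\nabla^{\beta\gamma}_{jk}$ is the direct sum of the tensor product connections on $\bigoplus_jE^{\alpha\beta}_{ij}\otimes E^{\beta\gamma}_{jk}$, and $(\phi^{\alpha\beta\gamma})^*$ is entrywise pullback of connections along the bundle isomorphism $\phi^{\alpha\beta\gamma}$. The space of connective structures is topologized as a subspace of the product of the affine spaces of smooth connections with their $C^\infty$ topology. *)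

(* Defs.v *)
From HB Require Import structures.
From mathcomp Require Import all_boot all_order all_algebra.
From mathcomp Require Import all_classical all_reals all_analysis.
From mathcomp Require Import complex mxtens.
Set Implicit Arguments.
Unset Strict Implicit.
Unset Printing Implicit Defensive.
Import Order.TTheory GRing.Theory Num.Theory.
Import numFieldNormedType.Exports.
Local Open Scope classical_set_scope.
Local Open Scope ring_scope.
Local Open Scope complex_scope.

(** * General topology *)

Definition locally_finite (M : topologicalType) (I : Type) (W : I -> set M) :=
  forall x : M, exists N : set M,
    nbhs x N /\ finite_set [set i | W i `&` N !=set0].

Definition open_cover (M : topologicalType) (I : Type) (W : I -> set M) :=
  (forall i, open (W i)) /\ (forall x, exists i, W i x).

Definition paracompact (M : topologicalType) :=
  forall (I : Type) (W : I -> set M), open_cover W ->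
  exists (K : Type) (V : K -> set M),
    [/\ open_cover V, locally_finite V & forall k, exists i, V k `<=` W i].

(* The subspace [S] of [X] is contractible (hence in particular non-empty). *)
Definition contractible (R : realType) (X : topologicalType) (S : set X) :=
  exists (x0 : X) (H : X * R -> X),
    [/\ S x0,
        {within S `*` `[0, 1], continuous H},
        forall p, (S `*` `[0, 1]) p -> S (H p),
        forall x, S x -> H (x, 0) = x
      & forall x, S x -> H (x, 1) = x0].

(** * Smooth functions on open subsets of R^d *)

Definition pderivs (R : realType) (d : nat) (ks : seq 'I_d) (f : 'rV[R]_d -> R) :
    'rV[R]_d -> R :=
  foldr (fun k (g : 'rV[R]_d -> R) => 'D_(delta_mx 0 k) g) f ks.

(* All iterated partial derivatives exist and are continuous on [O]. *)
Definition Cinfty (R : realType) (d : nat) (O : set 'rV[R]_d)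
    (f : 'rV[R]_d -> R) :=
  forall (ks : seq 'I_d) y, O y ->
    {for y, continuous (pderivs ks f)} /\
    forall k, derivable (pderivs ks f) y (delta_mx 0 k).

(** * Manifolds *)

(* [cinv c] is only meaningful on the image of [cdom c] under [cmap c]. *)
Record smooth_atlas (R : realType) (d : nat) (M : topologicalType) :=
  SmoothAtlas {
    chart : Type;
    cdom : chart -> set M;
    cmap : chart -> M -> 'rV[R]_d;
    cinv : chart -> 'rV[R]_d -> M;
    cdom_cover : open_cover cdom;
    cimg_open : forall c, open (cmap c @` cdom c);
    cmapK : forall c x, cdom c x -> cinv c (cmap c x) = x;
    cmap_continuous : forall c x, cdom c x -> {for x, continuous (cmap c)};
    cinv_continuous : forall c x, cdom c x ->
      {for cmap c x, continuous (cinv c)};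
    transition_smooth : forall c c' (l : 'I_d),
      Cinfty (cmap c @` (cdom c `&` cdom c'))
             (fun y => cmap c' (cinv c y) 0 l)
  }.

Section Calculus.
Context {R : realType} {d : nat} {M : topologicalType}.
Variable A : smooth_atlas R d M.

Definition smooth_on (V : set M) (f : M -> R) :=
  forall c : chart A, Cinfty (cmap c @` (V `&` cdom c)) (f \o cinv c).

Definition csmooth_on (V : set M) (f : M -> R[i]) :=
  smooth_on V (fun x => complex.Re (f x)) /\
  smooth_on V (fun x => complex.Im (f x)).

Definition mxsmooth_on p q (V : set M) (F : M -> 'M[R[i]]_(p, q)) :=
  forall i j, csmooth_on V (fun x => F x i j).

(* Partial derivative of [f] along the k-th coordinate of the chart [c]. *)
Definition partial (c : chart A) (k : 'I_d) (f : M -> R) (x : M) : R :=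
  'D_(delta_mx 0 k) (f \o cinv c) (cmap c x).

Definition cpartial (c : chart A) (k : 'I_d) (f : M -> R[i]) (x : M) : R[i] :=
  partial c k (fun y => complex.Re (f y)) x
  +i* partial c k (fun y => complex.Im (f y)) x.

Definition partitions_of_unity :=
  forall (I : choiceType) (W : I -> set M), open_cover W ->
  exists rho : I -> M -> R,
    [/\ forall i, smooth_on setT (rho i),
        forall i x, 0 <= rho i x,
        forall i, closure [set x | rho i x != 0] `<=` W i,
        locally_finite (fun i => closure [set x | rho i x != 0])
      & forall x, \sum_(i \in [set: I]) rho i x = 1].

(** ** C^m-valued 1-forms *)

(* [eta c x k] is the value of the 1-form [eta] at [x] on the k-th coordinate
   vector field of the chart [c]; it is meaningful for [x] in [cdom c]. *)
Definition vform (m : nat) := chart A -> M -> 'I_d -> 'cV[R[i]]_m.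

Definition smooth_form m (V : set M) (eta : vform m) :=
  (forall c k, mxsmooth_on (V `&` cdom c) (fun x => eta c x k)) /\
  (forall c c' x k, V x -> cdom c x -> cdom c' x ->
     eta c x k =
     \sum_(l < d) (partial c k (fun y => cmap c' y 0 l) x)%:C *: eta c' x l).

(** ** Connections on trivial bundles *)

(* A connection on the trivial bundle over U with fibre C^m is a covariant
   derivative acting on local sections, i.e. a morphism from the sheaf of
   smooth sections to the sheaf of smooth 1-forms on U satisfying the Leibniz
   rule. *)
Definition cov_op (m : nat) := (M -> 'cV[R[i]]_m) -> vform m.

(* The last clause fixes the values of [D s c x] which carry no information
   (outside of U, of the chart, or where [s] is not smooth), so that distinct
   elements of [cov_op m] satisfying [connection] are distinct connections. *)
Definition connection m (U : set M) (D : cov_op m) :=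
  [/\ forall V s, open V -> V `<=` U -> mxsmooth_on V s -> smooth_form V (D s),
      forall V s t, open V -> V `<=` U -> mxsmooth_on V s -> mxsmooth_on V t ->
        forall c x k, V x -> cdom c x ->
        D (fun y => s y + t y) c x k = D s c x k + D t c x k,
      forall V f s, open V -> V `<=` U -> csmooth_on V f -> mxsmooth_on V s ->
        forall c x k, V x -> cdom c x ->
        D (fun y => f y *: s y) c x k =
        cpartial c k f x *: s x + f x *: D s c x k
    & forall s c x k,
        ~ (cdom c x /\
           exists V, [/\ open V, V x, V `<=` U & mxsmooth_on V s]) ->
        D s c x k = 0].

(* Equality of connections after restriction to the open set [V]. *)
Definition conn_eq m (V : set M) (D D' : cov_op m) :=
  forall W s, open W -> W `<=` V -> mxsmooth_on W s ->
  forall c x k, W x -> cdom c x -> D s c x k = D' s c x k.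

(* phi^* D = phi^-1 o D o phi; [pinvmx] is the two-sided inverse on invertible
   matrices. *)
Definition conn_pull p q (phi : M -> 'M[R[i]]_(q, p)) (D : cov_op q) :
    cov_op p :=
  fun s c x k => pinvmx (phi x) *m D (fun y => phi y *m s y) c x k.

Definition conn_dsum n (p : 'I_n -> nat) (D : forall j, cov_op (p j)) :
    cov_op (\sum_j p j) :=
  fun s c x k => \mxcol_j D j (fun y => submxcol (s y) j) c x k.

Definition tens_cv p q (u : 'cV[R[i]]_p) (v : 'cV[R[i]]_q) : 'cV[R[i]]_(p * q) :=
  tensmx u v.

(* A section of C^p (x) C^q is written s = \sum_b s_b (x) e_b, and the rule
   D (s_b (x) e_b) = D s_b (x) e_b + s_b (x) D' e_b is applied to each term. *)
Definition conn_tens p q (D : cov_op p) (D' : cov_op q) : cov_op (p * q) :=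
  fun s c x k =>
    let slice b y := \col_a s y (mxtens_index (a, b)) 0 in
    \sum_(b < q) (tens_cv (D (slice b) c x k) (delta_mx b 0)
                  + tens_cv (slice b x) (D' (cst (delta_mx b 0)) c x k)).

End Calculus.

Arguments cov_op {R d M} A m.

(** * Matrices over the category of finite-dimensional vector spaces *)

Section MatrixCategory.
Variable n : nat.

Definition vobj := 'I_n -> 'I_n -> nat.

Definition vobj_mul (E F : vobj) : vobj :=
  fun i k => (\sum_(j < n) E i j * F j k)%N.

Definition vobj_one : vobj := fun i j => (i == j) : nat.

Definition vobj_gl (E : vobj) :=
  \det (\matrix_(i, j) (E i j)%:Z) \in [:: 1; -1].

Variable C : fieldType.

(* Morphisms E -> E'. They are typed as families of rectangular matrices, the
   invertible ones existing only if E and E' are equal. This dispenses with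
   transports between objects that are only propositionally equal. *)
Definition vhom (E E' : vobj) := forall i j, 'M[C]_(E' i j, E i j).

Definition vhom_iso E E' (f : vhom E E') :=
  forall i j, row_free (f i j) && row_full (f i j).

(* The identity of E, when E and E' are equal. *)
Definition vhom_id E E' : vhom E E' :=
  fun i j => \matrix_(r, c) ((r == c :> nat)%:R).

Definition vhom_comp E F G (g : vhom F G) (f : vhom E F) : vhom E G :=
  fun i j => g i j *m f i j.

(* (f . g)_ik is the block sum over j of f_ij (x) g_jk. *)
Definition vhom_mul E E' F F' (f : vhom E E') (g : vhom F F') :
    vhom (vobj_mul E F) (vobj_mul E' F') :=
  fun i k => \mxblock_(j < n, j' < n)
    if j == j' then conform_mx 0 (tensmx (f i j) (g j k)) else 0.

(* The permutation matrix identifying the basis vector labelled (j, a, (k, b, c))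
   of (+)_j E_ij (x) ((+)_k F_jk (x) G_kl) with the basis vector labelled
   (k, (j, a, b), c) of (+)_k ((+)_j E_ij (x) F_jk) (x) G_kl. *)
Definition vassoc E F G :
    vhom (vobj_mul E (vobj_mul F G)) (vobj_mul (vobj_mul E F) G) :=
  fun i l => \matrix_(r, s)
    let k := tagnat.sig1 r in
    let uc := mxtens_unindex (tagnat.sig2 r) in
    let j := tagnat.sig1 uc.1 in
    let ab := mxtens_unindex (tagnat.sig2 uc.1) in
    let j' := tagnat.sig1 s in
    let av := mxtens_unindex (tagnat.sig2 s) in
    let k' := tagnat.sig1 av.2 in
    let bc := mxtens_unindex (tagnat.sig2 av.2) in
    ([&& j == j', k == k', ab.1 == av.1 :> nat, ab.2 == bc.1 :> nat
       & uc.2 == bc.2 :> nat])%:R.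

End MatrixCategory.

(** * Charted 2-vector bundles *)

Section Bundles.
Context {R : realType} {d : nat} {M : topologicalType}.
Variables (A : smooth_atlas R d M) (n : nat).

(* The values of [obj a b] and [coh a b c x] are meaningful only for a < b,
   resp. for a < b < c and x in the intersection of the corresponding sets. *)
Record charted_2vb disp (J : porderType disp) := Charted2VB {
  cov : J -> set M;
  obj : J -> J -> vobj n;
  coh : forall a b c, M -> vhom R[i] (vobj_mul (obj a b) (obj b c)) (obj a c);
  cov_cover : open_cover cov;
  cov_total : forall s : seq J,
    (exists x, forall a, a \in s -> cov a x) -> {in s &, total <=%O};
  obj_gl : forall a b, (a < b)%O -> vobj_gl (obj a b);
  obj_mul : forall a b c, (a < b)%O -> (b < c)%O ->
    vobj_mul (obj a b) (obj b c) =2 obj a c;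
  coh_iso : forall a b c x, (a < b)%O -> (b < c)%O ->
    (cov a `&` cov b `&` cov c) x -> vhom_iso (coh a b c x);
  coh_smooth : forall a b c i k, (a < b)%O -> (b < c)%O ->
    mxsmooth_on A (cov a `&` cov b `&` cov c) (fun x => coh a b c x i k);
  coh_assoc : forall a b c e x i l, (a < b)%O -> (b < c)%O -> (c < e)%O ->
    (cov a `&` cov b `&` cov c `&` cov e) x ->
    vhom_comp (coh a b e x)
      (vhom_mul (vhom_id R[i] (obj a b) (obj a b)) (coh b c e x)) i l =
    vhom_comp (coh a c e x)
      (vhom_comp
        (vhom_mul (coh a b c x) (vhom_id R[i] (obj c e) (obj c e)))
        (vassoc R[i] (obj a b) (obj b c) (obj c e))) i l
}.

(* [conform_mx] is a transport along the equalities of dimensions given by the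
   clause on objects. *)
Definition elementary_refinement disp (J : porderType disp)
    disp' (J' : porderType disp')
    (E : charted_2vb J) (kappa : J' -> J) (E' : charted_2vb J') :=
  [/\ {homo kappa : a b / (a <= b)%O},
      forall a, cov E' a `<=` cov E (kappa a),
      forall a b, (a < b)%O ->
        obj E' a b =2 (if kappa a == kappa b then @vobj_one n
                       else obj E (kappa a) (kappa b))
    & forall a b c x i k, (a < b)%O -> (b < c)%O ->
        (cov E' a `&` cov E' b `&` cov E' c) x ->
        coh E' a b c x i k =
        if (kappa a == kappa b) || (kappa b == kappa c)
        then @vhom_id n _ _ _ i k
        else conform_mx 0 (coh E (kappa a) (kappa b) (kappa c) x i k)].

(** ** Connective structures *)

Section Connective.
Context {disp : Order.disp_t} {J : porderType disp}.
Variable E : charted_2vb J.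

Definition conn_family : Type :=
  forall a b : J, (a < b)%O -> forall i j, cov_op A (obj E a b i j).

Definition conn_mul (F G : vobj n) (D : forall i j, cov_op A (F i j))
    (D' : forall i j, cov_op A (G i j)) i k : cov_op A (vobj_mul F G i k) :=
  conn_dsum (fun j => conn_tens (D i j) (D' j k)).
Arguments conn_mul {F G} D D' i k.

Definition connective_structure (D : conn_family) :=
  (forall a b (ab : (a < b)%O) i j,
     connection (cov E a `&` cov E b) (D a b ab i j)) /\
  (forall a b c (ab : (a < b)%O) (bc : (b < c)%O) (ac : (a < c)%O) i k,
     conn_eq (cov E a `&` cov E b `&` cov E c)
       (conn_pull (fun x => coh E a b c x i k) (D a c ac i k))
       (conn_mul (D a b ab) (D b c bc) i k)).

(** *** The C^oo topology *)

(* The C^oo topology on the connections d + omega is that of uniform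
   convergence on compact sets of all partial derivatives of all the
   coefficients of the matrix of 1-forms omega, in all charts. The column of
   index [jcol] of omega is the 1-form obtained by applying the connection to
   the corresponding constant section; [jre] selects the real or the imaginary
   part. *)
Record jet_index := JetIndex {
  jsrc : J;
  jtgt : J;
  jlt : (jsrc < jtgt)%O;
  ji : 'I_n;
  jj : 'I_n;
  jrow : 'I_(obj E jsrc jtgt ji jj);
  jcol : 'I_(obj E jsrc jtgt ji jj);
  jchart : chart A;
  jdir : 'I_d;
  jre : bool;
  jders : seq 'I_d
}.

Definition jet_compacts (u : jet_index) (K : set 'rV[R]_d) :=
  compact K /\
  K `<=` cmap (jchart u) @`
           (cov E (jsrc u) `&` cov E (jtgt u) `&` cdom (jchart u)).

Definition jet (D : conn_family) :
    prod_topology (fun u : jet_index =>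
      {family (jet_compacts u), 'rV[R]_d -> R}) :=
  fun u => pderivs (jders u) (fun y =>
    let z := D _ _ (jlt u) (ji u) (jj u) (cst (delta_mx (jcol u) 0))
               (jchart u) (cinv (jchart u) y) (jdir u) (jrow u) 0 in
    if jre u then complex.Re z else complex.Im z).

HB.instance Definition _ := gen_eqMixin conn_family.
HB.instance Definition _ := gen_choiceMixin conn_family.

Definition conn_space : topologicalType := initial_topology jet.

End Connective.

End Bundles.

(* Main.v *)
Require Import Defs.
From mathcomp Require Import all_boot all_order all_algebra.
From mathcomp Require Import all_classical all_reals all_analysis.
From mathcomp Require Import complex mxtens ring.
Set Implicit Arguments.
Unset Strict Implicit.
Unset Printing Implicit Defensive.
Import Order.TTheory GRing.Theory Num.Theory.
Import numFieldNormedType.Exports.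
Local Open Scope classical_set_scope.
Local Open Scope ring_scope.

(** A connection on a trivial bundle is an operator [D] on sections subject to
    conditions that are affine in [D]. With the connections of [E^{ab}] and
    [E^{bc}] written as [d + omega] and [d + omega'], the connection on the
    product is [d + omega . id + id . omega'], and pullback along a coherency map
    is also affine. Hence combinations of connective structures, with weights
    that are functions on [M] with sum [1], are again connective structures
    ([glue_connective]). Both halves of the theorem rest on this.

    The space of connective structures is convex. Choosing one of them, [D0],
    contracts it along the segments [(1 - t) D + t D0]. This is continuous for
    the topology of uniform convergence of all derivatives on compact sets
    because a derivative of [(1 - t) D + t D0] is the same combination of the
    derivatives of [D] and [D0], which are bounded on compact sets
    ([segment_continuous], [connective_contractible]).

    Existence is a local question, since local connective structures are glued
    by a partition of unity ([connective_structure_exists]). The refinement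
    provides the local solutions. Let [rho] be a partition of unity subordinate
    to the cover, and replace each open set by the smaller one where [rho a] does
    not vanish; the carrier function is the identity. The closures of the new
    sets are locally finite and lie in the old sets. So near a given point only a
    finite chain of indices matters, and the coherency maps between these are
    defined on a whole neighbourhood [W] of the point
    ([local_connective_exists]).

    Over [W] one goes up the chain, constructing frames [Phi] of the
    bundles [E^{ab}] in which all coherency maps have constant matrices. The
    frame of [E^{ac}] is transported along a coherency map from those of [E^{ae}]
    and [E^{ec}], where [e] is the index just below [c], and the coherence
    condition makes the remaining coherency maps constant ([chain_frames]). Let the connection on [E^{ab}] be
    the one for which the frame is parallel, [D s = Phi d (Phi^-1 s)]. Since the
    product of two frames is parallel for the product connection, a coherency map
    with constant matrix carries parallel frames to parallel sections, so it
    pulls back [D^{ac}] to [D^{ab} . D^{bc}] ([conn_pull_flat]).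

    The calculus that this uses consists of the stability of smooth functions
    under sums, products, inverses and changes of coordinates. All of it reduces
    to the chain rule for functions with continuous partial derivatives
    ([derive_chain]). *)

(** * Calculus on open subsets of R^d *)

Section ChainRule.
Context {R : realType}.

Lemma row_coord_le d (u : 'rV[R]_d) l : `|u 0 l| <= `|u|.
Proof.
by rewrite {2}/Num.Def.normr/= mx_normrE (le_bigmax _ (fun i => `|u i.1 i.2|) (0, l)).
Qed.

Lemma row_norm_lt d (u : 'rV[R]_d) e :
  0 < e -> (forall l, `|u 0 l| < e) -> `|u| < e.
Proof.
move=> e0 ue; rewrite {1}/Num.Def.normr/= mx_normrE bigmax_lt// => -[i j] _ /=.
by rewrite (ord1 i).
Qed.

(** The mean value theorem for [t |-> f (t v + p)] on the interval between [0] and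
    [s], which may have either sign. *)
Lemma mean_value_line (V : normedModType R) (f : V -> R) (p v : V) (s : R) :
  (forall t : R, `|t| <= `|s| -> derivable f (t *: v + p) v) ->
  exists2 t : R, `|t| <= `|s| & f (s *: v + p) - f p = s * 'D_v f (t *: v + p).
Proof.
move=> df; pose g t := f (t *: v + p).
have dg (t : R) : `|t| <= `|s| -> is_derive t (1 : R) g ('D_v f (t *: v + p)).
  move=> ts; have := df _ ts; rewrite /derivable /derive => dft.
  suff E : (fun h => h^-1 *: ((g \o shift t) (h *: (1 : R)) - g t)) =
           (fun h => h^-1 *: ((f \o shift (t *: v + p)) (h *: v) - f (t *: v + p))).
    by apply: DeriveDef; rewrite /derivable /derive E.
  apply/funext => h; congr (_ *: (_ - _)).
  by rewrite /g /= addrA -scalerDl [_%:A]mulr1.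
have cg (t : R) : `|t| <= `|s| -> {for t, continuous g}.
  move=> ts; have [dgt _] := dg _ ts.
  by apply: differentiable_continuous; apply/derivable1_diffP.
have [s0|s0] := leP 0 s.
  have Is t : t \in `[0, s] -> `|t| <= `|s|.
    by rewrite in_itv/= => /andP[t0 ts]; rewrite !ger0_norm.
  have [||t tI E] := @MVT_segment R g (fun t => 'D_v f (t *: v + p)) 0 s s0.
  - by move=> x xI; apply: dg; apply: Is; rewrite inE; apply: subset_itv_oo_cc.
  - by apply: continuous_in_subspaceT => x /set_mem xI; apply: cg; exact: Is.
  exists t; first exact: Is.
  by move: E; rewrite /g scale0r add0r subr0 mulrC.
have Is t : t \in `[s, 0] -> `|t| <= `|s|.
  rewrite in_itv/= => /andP[st t0]; rewrite !ler0_norm// ?lerN2//; exact: ltW.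
have [||t tI E] := @MVT_segment R g (fun t => 'D_v f (t *: v + p)) s 0 (ltW s0).
- by move=> x xI; apply: dg; apply: Is; rewrite inE; apply: subset_itv_oo_cc.
- by apply: continuous_in_subspaceT => x /set_mem xI; apply: cg; exact: Is.
exists t; first exact: Is.
move: E; rewrite /g scale0r add0r sub0r => /(congr1 -%R).
by rewrite opprB => ->; ring.
Qed.

(** Moving one coordinate at a time writes the increment of [f] as a sum of
    increments along coordinate axes. The mean value theorem turns each of them
    into a value of a partial derivative near [z], which continuity compares with
    the value at [z]. *)
Lemma increment_bound d (f : 'rV[R]_d -> R) z (e : R) : 0 < e ->
  (forall l : 'I_d, \forall y \near z, derivable f y (delta_mx 0 l)) ->
  (forall l : 'I_d, {for z, continuous ('D_(delta_mx 0 l) f)}) ->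
  \forall y \near z,
    `|f y - f z - \sum_l (y - z) 0 l * 'D_(delta_mx 0 l) f z|
      <= e * \sum_l `|(y - z) 0 l|.
Proof.
move=> e0 df cf.
have nearP (l : 'I_d) : \forall y \near z, derivable f y (delta_mx 0 l) /\
    `|'D_(delta_mx 0 l) f z - 'D_(delta_mx 0 l) f y| < e.
  near=> y; split; first by near: y; exact: df.
  near: y.
  by move/cvgrPdist_lt : (cf l); apply.
have : \forall y \near z, forall l : 'I_d, derivable f y (delta_mx 0 l) /\
    `|'D_(delta_mx 0 l) f z - 'D_(delta_mx 0 l) f y| < e.
  exact: (filter_forall (nbhs_filter z) nearP).
move=> /nbhs_ballP[r /= r0 Hr]; apply/nbhs_ballP; exists r => // y.
rewrite -ball_normE /= -normrN opprB => yz; set u := y - z in yz *.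
(* [z + w m] agrees with [y] in the first [m] coordinates and with [z] in the
   others. *)
pose w (m : nat) : 'rV[R]_d := \row_l (if (l < m)%N then u 0 l else 0).
have -> : y = z + w d.
  by apply/rowP => l; rewrite !mxE ltn_ord; ring.
have w0 : z + w 0%N = z by apply/rowP => l; rewrite !mxE /= addr0.
rewrite -[in X in _ - X - _]w0.
rewrite -(@telescope_sumr _ 0 d (fun m => f (z + w m)))// big_mkord.
rewrite -sumrB mulr_sumr (le_trans (ler_norm_sum _ _ _))// ler_sum// => m _.
have wS : z + w m.+1 = u 0 m *: delta_mx 0 m + (z + w m).
  apply/rowP => l; rewrite !mxE /= ltnS leq_eqVlt.
  case: (eqVneq l m) => [->|lm]; rewrite ?eqxx ?ltnn /=; first ring.
  by rewrite val_eqE (negbTE lm) /= mulr0 add0r.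
have near_z t : `|t| <= `|u 0 m| -> ball z r (t *: delta_mx 0 m + (z + w m)).
  move=> tu; rewrite -ball_normE /= row_norm_lt// => l; rewrite !mxE /=.
  have ul : `|u 0 l| < r by apply: le_lt_trans yz; exact: row_coord_le.
  case: (eqVneq l m) => [lm|lm] /=.
    rewrite lm ltnn; have -> : z 0 m - (t * 1 + (z 0 m + 0)) = - t by ring.
    by rewrite normrN (le_lt_trans tu)// -lm.
  case: ifP => _.
    by rewrite [X in `|X|](_ : _ = - u 0 l) ?normrN// !mxE; ring.
  by rewrite mulr0 add0r addr0 subrr normr0.
have [|t tu E] := @mean_value_line _ f (z + w m) (delta_mx 0 m) (u 0 m).
  by move=> t /near_z/Hr/(_ m)[].
rewrite -wS in E; rewrite E -mulrBr normrM mulrC.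
apply: ler_wpM2r => //; rewrite distrC ltW//.
by have /Hr/(_ m)[] := near_z _ tu.
Unshelve. all: by end_near. Qed.

Lemma row_cvg (T : Type) (F : set_system T) {FF : Filter F} d
    (g : T -> 'rV[R]_d) (y : 'rV[R]_d) :
  (forall l, (fun t => g t 0 l) @ F --> y 0 l) -> g @ F --> y.
Proof.
move=> H; apply/cvgrPdist_lt => e e0.
have : \forall t \near F, forall l : 'I_d, `|y 0 l - g t 0 l| < e.
  by apply: (@filter_forall _ 'I_d) => k; move/cvgrPdist_lt : (H k) => /(_ e e0).
by apply: filterS => t tl; apply: row_norm_lt => // l; rewrite !mxE.
Qed.

Lemma cvg_sumr (T : Type) (F : set_system T) {FF : Filter F} (I : Type)
    (r : seq I) (f : I -> T -> R) (a : I -> R) :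
  (forall i, f i @ F --> a i) ->
  (fun t => \sum_(i <- r) f i t) @ F --> \sum_(i <- r) a i.
Proof.
move=> fa; elim: r => [|i r IH].
  by rewrite big_nil; under eq_fun do rewrite big_nil; exact: cvg_cst.
by rewrite big_cons; under eq_fun do rewrite big_cons; exact: cvgD.
Qed.

(** Continuous partial derivatives of [f] suffice, although the outer function is
    not assumed to be differentiable: the difference quotient of [f \o g] differs
    from the sum of the partial derivatives, weighted by the difference quotients
    [q l] of the coordinates of [g], by an error that [increment_bound] makes
    small relative to the bounded quantity [\sum_l `|q l h|]. *)
Lemma derive_chain (V : normedModType R) d (f : 'rV[R]_d -> R)
    (g : V -> 'rV[R]_d) (x v : V) :
  (forall l : 'I_d, \forall y \near g x, derivable f y (delta_mx 0 l)) ->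
  (forall l : 'I_d, {for g x, continuous ('D_(delta_mx 0 l) f)}) ->
  {for x, continuous g} ->
  (forall l, derivable (fun t => g t 0 l) x v) ->
  is_derive x v (f \o g)
    (\sum_l 'D_v (fun t => g t 0 l) x * 'D_(delta_mx 0 l) f (g x)).
Proof.
move=> df cf cg dg; set L := \sum_l _.
suff cL : (fun h => h^-1 *: (((f \o g) \o shift x) (h *: v) - (f \o g) x))
    @ 0^' --> L.
  by apply: DeriveDef; [apply/cvg_ex; exists L | apply/cvg_lim].
pose q l h : R := h^-1 *: (((fun t => g t 0 l) \o shift x) (h *: v) - g x 0 l).
have cq l : q l @ 0^' --> 'D_v (fun t => g t 0 l) x by exact: dg.
pose a l := 'D_v (fun t => g t 0 l) x.
have csum : (fun h => \sum_l q l h * 'D_(delta_mx 0 l) f (g x)) @ 0^' --> L.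
  apply: cvg_sumr => l; apply: cvgM; [exact: cq|exact: cvg_cst].
have cabs : (fun h => \sum_l `|q l h|) @ 0^' --> \sum_l `|a l|.
  by apply: cvg_sumr => l; apply: cvg_norm; exact: cq.
rewrite -[L]add0r -[X in X @ _](subrK (fun h => \sum_l q l h * 'D_(delta_mx 0 l) f (g x))).
apply: cvgD => //.
apply/cvgrPdist_le => e e0.
pose B := \sum_l `|a l| + 1.
have B0 : 0 < B by rewrite ltr_wpDl// sumr_ge0.
have shift0 : (fun h : R => h *: v + x) @ 0^' --> x.
  rewrite -[in X in _ --> X](add0r x) -(scale0r v).
  apply: cvgD; last exact: cvg_cst.
  apply: cvgZ; last exact: cvg_cst.
  exact: (cvg_within (F := nbhs 0)).
have near_inc := increment_bound (divr_gt0 e0 B0) df cf.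
have inc : \forall h \near 0^', `|f (g (h *: v + x)) - f (g x)
      - \sum_l (g (h *: v + x) - g x) 0 l * 'D_(delta_mx 0 l) f (g x)|
      <= e / B * \sum_l `|(g (h *: v + x) - g x) 0 l|.
  have cgs : (fun h : R => g (h *: v + x)) @ 0^' --> g x.
    exact: (cvg_comp (fun h : R => h *: v + x) g shift0 cg).
  exact: cgs near_inc.
near=> h.
have h0 : h != 0 by near: h; exact: nbhs_dnbhs_neq.
rewrite sub0r normrN /=.
have qE l : (g (h *: v + x) - g x) 0 l = h * q l h.
  by rewrite /q /= /GRing.scale /= mulrA divff// mul1r !mxE.
have incE : `|f (g (h *: v + x)) - f (g x)
      - \sum_l (h * q l h) * 'D_(delta_mx 0 l) f (g x)|
      <= e / B * \sum_l `|h * q l h|.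
  under eq_bigr do rewrite -qE; under [in leRHS]eq_bigr do rewrite -qE.
  by near: h.
rewrite [X in `|X|](_ : _ = h^-1 * (f (g (h *: v + x)) - f (g x)
      - \sum_l (h * q l h) * 'D_(delta_mx 0 l) f (g x))); last first.
  transitivity (h^-1 * (f (g (h *: v + x)) - f (g x))
    - (\sum_l q l h * 'D_(delta_mx 0 l) f (g x))); first by [].
  under [in RHS]eq_bigr do rewrite -mulrA.
  by rewrite -mulr_sumr [RHS]mulrBr mulKf.
rewrite normrM normfV ler_pdivrMl ?normr_gt0//.
apply: (le_trans incE).
under eq_bigr do rewrite normrM.
rewrite -mulr_sumr mulrCA ler_pM2l ?normr_gt0//.
rewrite mulrAC ler_pdivrMr// ler_pM2l//.
near: h.
have := cvgr_le (\sum_l `|a l|) cabs.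
by apply; rewrite ltrDl.
Unshelve. all: by end_near. Qed.

End ChainRule.

Section PointwiseContinuity.
Context {R : realType} {T : topologicalType}.
Implicit Types (f g : T -> R) (y : T).

Lemma for_continuous_eq f g y : (\forall z \near y, f z = g z) ->
  {for y, continuous f} -> {for y, continuous g}.
Proof.
move=> fg cf; rewrite /prop_for /continuous_at -(nbhs_singleton fg).
by apply: cvg_trans cf; apply: near_eq_cvg; apply: filterS fg => z ->.
Qed.

Lemma for_continuous_cst (a : R) y : {for y, continuous (fun=> a)}.
Proof. exact: cvg_cst. Qed.

Lemma for_continuous_row d (h : T -> 'rV[R]_d) y :
  (forall l, {for y, continuous (fun z => h z 0 l)}) -> {for y, continuous h}.
Proof. by move=> ch; apply: row_cvg => l; exact: ch. Qed.

Lemma for_continuousD f g y : {for y, continuous f} -> {for y, continuous g} ->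
  {for y, continuous (fun z => f z + g z)}.
Proof. by move=> cf cg; exact: cvgD. Qed.

Lemma for_continuousM f g y : {for y, continuous f} -> {for y, continuous g} ->
  {for y, continuous (fun z => f z * g z)}.
Proof. by move=> cf cg; exact: cvgM. Qed.

Lemma for_continuousV f y : f y != 0 -> {for y, continuous f} ->
  {for y, continuous (fun z => (f z)^-1)}.
Proof. by move=> fy cf; exact: cvgV. Qed.

Lemma for_continuous_norm f y : {for y, continuous f} ->
  {for y, continuous (fun z => `|f z|)}.
Proof. by move=> cf; exact: cvg_norm. Qed.

End PointwiseContinuity.

Section Ck.
Context {R : realType} {d : nat}.
Implicit Types (O : set 'rV[R]_d) (f g : 'rV[R]_d -> R).

(** [Cinfty] is the intersection of these classes ([CinftyP]). As [Ck n.+1]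
    refers to [Ck n] of the first derivatives, the derivative of a product or of a
    composite, which involves the original functions and their derivatives, is
    covered by induction on the order. *)
Fixpoint Ck (n : nat) O f : Prop :=
  (forall y, O y -> {for y, continuous f}) /\
  if n is m.+1 then forall k : 'I_d,
    (forall y, O y -> derivable f y (delta_mx 0 k)) /\ Ck m O ('D_(delta_mx 0 k) f)
  else True.

Lemma Ck_continuous n O f y : Ck n O f -> O y -> {for y, continuous f}.
Proof. by case: n => [|n] [cf _]; exact: cf. Qed.

Lemma Ck_derivable n O f y k : Ck n.+1 O f -> O y -> derivable f y (delta_mx 0 k).
Proof. by case=> _ /(_ k)[df _]; exact: df. Qed.

Lemma Ck_derive n O f k : Ck n.+1 O f -> Ck n O ('D_(delta_mx 0 k) f).
Proof. by case=> _ /(_ k)[]. Qed.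

Lemma CkS n O f : Ck n.+1 O f -> Ck n O f.
Proof.
elim: n f => [|n IH] f [cf df]; split => // k.
by have [dfk Cf] := df k; split => //; exact: IH.
Qed.

Lemma pderivs_rcons ks (k : 'I_d) f :
  pderivs (rcons ks k) f = pderivs ks ('D_(delta_mx 0 k) f).
Proof. by rewrite /pderivs foldr_rcons. Qed.

Lemma CinftyP O f : Cinfty O f <-> forall n, Ck n O f.
Proof.
split.
  move=> Cf n; elim: n f Cf => [|n IH] f Cf.
    by split=> // y Oy; case: (Cf [::] y Oy).
  split=> [y Oy|k]; first by case: (Cf [::] y Oy).
  split=> [y Oy|]; first by case: (Cf [::] y Oy) => _; apply.
  by apply: IH => ks y Oy; have := Cf (rcons ks k) y Oy; rewrite pderivs_rcons.
move=> Cf ks; elim/last_ind: ks f Cf => [|ks k IH] f Cf y Oy.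
  split; first exact: (Ck_continuous (Cf 0%N)).
  by move=> k; exact: (@Ck_derivable 0 O f y k (Cf 1%N) Oy).
by rewrite pderivs_rcons; apply: IH => // n; exact: Ck_derive (Cf n.+1).
Qed.

Lemma Ck_sub n O O' f : O' `<=` O -> Ck n O f -> Ck n O' f.
Proof.
move=> O'O; elim: n f => [|n IH] f [cf df]; split => //; try by move=> y /O'O; exact: cf.
by move=> k; have [dfk Cf] := df k; split=> [y /O'O|]; [exact: dfk|exact: IH].
Qed.

Lemma near_open_eq O f g y : open O -> {in O, f =1 g} -> O y ->
  \forall z \near y, f z = g z.
Proof.
move=> oO fg Oy; have : \forall z \near y, O z by exact: open_nbhs_nbhs.
by apply: filterS => z /mem_set; exact: fg.
Qed.

Lemma Ck_eq n O f g : open O -> {in O, f =1 g} -> Ck n O f -> Ck n O g.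
Proof.
move=> oO; elim: n f g => [|n IH] f g fg [cf df].
  split=> // y Oy; exact: for_continuous_eq (near_open_eq oO fg Oy) (cf _ Oy).
split=> [y Oy|k].
  exact: for_continuous_eq (near_open_eq oO fg Oy) (cf _ Oy).
have [dfk Cf] := df k; split=> [y Oy|].
  by apply: near_eq_derivable (dfk _ Oy); exact: near_open_eq fg Oy.
apply: IH Cf => y /set_mem Oy.
by apply: near_eq_derive; exact: near_open_eq fg Oy.
Qed.

Lemma Ck_cst n O (a : R) : Ck n O (fun=> a).
Proof.
elim: n a => [|n IH] a; (split; first by move=> y _; exact: for_continuous_cst) => //.
move=> k; split=> [y _|]; first exact: derivable_cst.
have -> : 'D_(delta_mx 0 k) (fun _ : 'rV[R]_d => a) = (fun=> 0 : R).
  by apply/funext => y; exact: derive_cst.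
exact: IH.
Qed.

Lemma CkD n O f g : open O -> Ck n O f -> Ck n O g ->
  Ck n O (fun y => f y + g y).
Proof.
move=> oO; elim: n f g => [|n IH] f g Cf Cg.
  by split=> // y Oy; apply: for_continuousD; [exact: (Ck_continuous Cf)|exact: (Ck_continuous Cg)].
split=> [y Oy|k].
  by apply: for_continuousD; [exact: (Ck_continuous Cf)|exact: (Ck_continuous Cg)].
split=> [y Oy|].
  by apply: derivableD; [exact: (Ck_derivable Cf)|exact: (Ck_derivable Cg)].
apply: Ck_eq (IH _ _ (Ck_derive k Cf) (Ck_derive k Cg)) => // y /set_mem Oy.
by rewrite deriveD//; [exact: (Ck_derivable Cf)|exact: (Ck_derivable Cg)].
Qed.

Lemma CkM n O f g : open O -> Ck n O f -> Ck n O g ->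
  Ck n O (fun y => f y * g y).
Proof.
move=> oO; elim: n f g => [|n IH] f g Cf Cg.
  by split=> // y Oy; apply: for_continuousM; [exact: (Ck_continuous Cf)|exact: (Ck_continuous Cg)].
split=> [y Oy|k].
  by apply: for_continuousM; [exact: (Ck_continuous Cf)|exact: (Ck_continuous Cg)].
split=> [y Oy|].
  by apply: derivableM; [exact: (Ck_derivable Cf)|exact: (Ck_derivable Cg)].
have C1 := IH _ _ (CkS Cf) (Ck_derive k Cg).
have C2 := IH _ _ (CkS Cg) (Ck_derive k Cf).
apply: Ck_eq (CkD oO C1 C2) => // y /set_mem Oy.
by rewrite deriveM//; [exact: (Ck_derivable Cf)|exact: (Ck_derivable Cg)].
Qed.

Lemma CkV n O f : open O -> (forall y, O y -> f y != 0) -> Ck n O f ->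
  Ck n O (fun y => (f y)^-1).
Proof.
move=> oO f0; elim: n => [|n IH] Cf.
  by split=> // y Oy; apply: for_continuousV; [exact: f0|exact: (Ck_continuous Cf)].
split=> [y Oy|k].
  by apply: for_continuousV; [exact: f0|exact: (Ck_continuous Cf)].
split=> [y Oy|].
  by apply: derivableV; [exact: f0|exact: (Ck_derivable Cf)].
have C1 := IH (CkS Cf).
have C2 := CkM oO (Ck_cst n O (-1)) (CkM oO (CkM oO C1 C1) (Ck_derive k Cf)).
apply: Ck_eq C2 => // y /set_mem Oy.
rewrite deriveV//; [|exact: f0|exact: (Ck_derivable Cf)].
by rewrite -exprVn expr2 /GRing.scale /=; ring.
Qed.

Lemma Ck_sum n O (I : Type) (r : seq I) (F : I -> 'rV[R]_d -> R) : open O ->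
  (forall i, Ck n O (F i)) -> Ck n O (fun y => \sum_(i <- r) F i y).
Proof.
move=> oO CF; elim: r => [|i r IH].
  by under eq_fun do rewrite big_nil; exact: Ck_cst.
by under eq_fun do rewrite big_cons; exact: CkD.
Qed.

End Ck.

Section Composition.
Context {R : realType} {d d' : nat}.

Lemma Ck_derivable_chain n (O : set 'rV[R]_d') (f : 'rV[R]_d' -> R)
    (V : normedModType R) (g : V -> 'rV[R]_d') (x v : V) :
  open O -> Ck n.+1 O f -> O (g x) -> {for x, continuous g} ->
  (forall l, derivable (fun t => g t 0 l) x v) ->
  is_derive x v (f \o g)
    (\sum_l 'D_v (fun t => g t 0 l) x * 'D_(delta_mx 0 l) f (g x)).
Proof.
move=> oO Cf Ogx cg dg; apply: derive_chain cg dg => l.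
  have : \forall z \near g x, O z by exact: open_nbhs_nbhs.
  by apply: filterS => z Oz; exact: (Ck_derivable Cf).
exact: Ck_continuous (Ck_derive l Cf) Ogx.
Qed.

Lemma Ck_comp n (O : set 'rV[R]_d) (O' : set 'rV[R]_d')
    (f : 'rV[R]_d' -> R) (g : 'rV[R]_d -> 'rV[R]_d') :
  open O -> open O' -> (forall y, O y -> O' (g y)) ->
  Ck n O' f -> (forall l, Ck n O (fun y => g y 0 l)) -> Ck n O (f \o g).
Proof.
move=> oO oO' OO'; elim: n f => [|n IH] f Cf Cg; split => //.
- move=> y Oy; apply: continuous_comp; last exact: Ck_continuous Cf (OO' _ Oy).
  by apply: for_continuous_row => l; exact: Ck_continuous (Cg l) Oy.
- move=> y Oy; apply: continuous_comp; last exact: Ck_continuous Cf (OO' _ Oy).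
  by apply: for_continuous_row => l; exact: Ck_continuous (Cg l) Oy.
move=> k.
have H y : O y -> is_derive y (delta_mx 0 k) (f \o g)
    (\sum_l 'D_(delta_mx 0 k) (fun t => g t 0 l) y * 'D_(delta_mx 0 l) f (g y)).
  move=> Oy; apply: (Ck_derivable_chain oO' Cf (OO' _ Oy)).
    by apply: for_continuous_row => l; exact: Ck_continuous (Cg l) Oy.
  by move=> l; exact: (Ck_derivable (Cg l)).
split=> [y Oy|]; first by have [] := H _ Oy.
have Cs : Ck n O (fun y => \sum_l 'D_(delta_mx 0 k) (fun t => g t 0 l) y *
                                   ('D_(delta_mx 0 l) f \o g) y).
  apply: Ck_sum => // l; apply: CkM => //; first exact: Ck_derive (Cg l).
  by apply: IH => [|l']; [exact: Ck_derive|exact: CkS].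
by apply: Ck_eq Cs => // y /set_mem Oy; have [_ ->] := H _ Oy.
Qed.

End Composition.

(** * Smooth functions on a manifold *)

Section Manifold.
Context {R : realType} {d : nat} {M : topologicalType}.
Variable A : smooth_atlas R d M.
Implicit Types (V W : set M) (f g : M -> R) (c : chart A).

Lemma cdom_open c : open (cdom c).
Proof. by have [+ _] := cdom_cover A; apply. Qed.

Lemma chart_image_open V c : open V -> open (cmap c @` (V `&` cdom c)).
Proof.
move=> oV; rewrite openE => _ [x [Vx cx] <-]; rewrite /interior /=.
have h1 : \forall y \near cmap c x, (cmap c @` cdom c) y.
  by apply: open_nbhs_nbhs; split; [exact: cimg_open|exists x].
have h2 : \forall y \near cmap c x, V (cinv c y).
  apply: (cinv_continuous cx); rewrite /= cmapK//.
  exact: open_nbhs_nbhs.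
apply: filterS2 h1 h2 => y [z cz <-]; rewrite cmapK// => Vz.
by exists z.
Qed.

Lemma smooth_onP V f :
  smooth_on A V f <-> forall c n, Ck n (cmap c @` (V `&` cdom c)) (f \o cinv c).
Proof. by split=> Hf c; [exact/CinftyP|exact/CinftyP]. Qed.

Lemma smooth_on_sub V W f : W `<=` V -> smooth_on A V f -> smooth_on A W f.
Proof.
move=> WV Vf c ks _ [x [Wx cx] <-]; apply: Vf.
by exists x => //; split=> //; exact: WV.
Qed.

Lemma smooth_on_local V f :
  (forall x, V x -> exists2 W, W x & smooth_on A W f) -> smooth_on A V f.
Proof.
move=> Vf c ks _ [x [Vx cx] <-]; have [W Wx Wf] := Vf _ Vx.
by apply: Wf; exists x.
Qed.

Lemma smooth_on_eq V f g : open V -> (forall x, V x -> f x = g x) ->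
  smooth_on A V f -> smooth_on A V g.
Proof.
move=> oV fg /smooth_onP Vf; apply/smooth_onP => c n.
apply: Ck_eq (Vf c n); first exact: chart_image_open.
by move=> y /set_mem[x [Vx cx] <-]; rewrite /= cmapK// fg.
Qed.

Lemma smooth_on_cst V (a : R) : smooth_on A V (fun=> a).
Proof. by apply/smooth_onP => c n; exact: Ck_cst. Qed.

Lemma smooth_onD V f g : open V -> smooth_on A V f -> smooth_on A V g ->
  smooth_on A V (fun x => f x + g x).
Proof.
move=> oV /smooth_onP Vf /smooth_onP Vg; apply/smooth_onP => c n.
by apply: CkD; [exact: chart_image_open|exact: Vf|exact: Vg].
Qed.

Lemma smooth_onM V f g : open V -> smooth_on A V f -> smooth_on A V g ->
  smooth_on A V (fun x => f x * g x).
Proof.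
move=> oV /smooth_onP Vf /smooth_onP Vg; apply/smooth_onP => c n.
by apply: CkM; [exact: chart_image_open|exact: Vf|exact: Vg].
Qed.

Lemma smooth_onN V f : open V -> smooth_on A V f ->
  smooth_on A V (fun x => - f x).
Proof.
move=> oV Vf; have sM := smooth_onM oV (@smooth_on_cst V (-1)) Vf.
by apply: smooth_on_eq sM => // x _; rewrite mulN1r.
Qed.

Lemma smooth_onV V f : open V -> (forall x, V x -> f x != 0) ->
  smooth_on A V f -> smooth_on A V (fun x => (f x)^-1).
Proof.
move=> oV f0 /smooth_onP Vf; apply/smooth_onP => c n.
apply: CkV; [exact: chart_image_open| |exact: Vf].
by move=> _ [x [Vx cx] <-] /=; rewrite cmapK// f0.
Qed.

Lemma transition_Ck c c' V n (l : 'I_d) : V `<=` cdom c' ->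
  Ck n (cmap c @` (V `&` cdom c)) (fun y => cmap c' (cinv c y) 0 l).
Proof.
move=> Vc'; have /CinftyP/(_ n) := @transition_smooth _ _ _ A c c' l.
by apply: Ck_sub => _ [x [/Vc' ? ?] <-]; exists x.
Qed.

Lemma smooth_continuous f : smooth_on A setT f -> continuous f.
Proof.
move=> sf x; have [c cx] := (cdom_cover A).2 x.
have [cf _] := sf c [::] (cmap c x) (ex_intro2 _ _ x (conj I cx) erefl).
have h : {for x, continuous ((f \o cinv c) \o cmap c)}.
  by apply: continuous_comp; [exact: cmap_continuous|exact: cf].
apply: for_continuous_eq h.
have : \forall y \near x, cdom c y by exact/open_nbhs_nbhs/(conj (cdom_open c)).
by apply: filterS => y cy; rewrite /= cmapK.
Qed.

Lemma chart_near_eq V c x f g : open V -> V x -> cdom c x ->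
  (forall y, V y -> cdom c y -> f y = g y) ->
  \forall y \near cmap c x, (f \o cinv c) y = (g \o cinv c) y.
Proof.
move=> oV Vx cx fg; have : \forall y \near cmap c x, (cmap c @` (V `&` cdom c)) y.
  by apply: open_nbhs_nbhs; split; [exact: chart_image_open|exists x].
by apply: filterS => _ [y [Vy cy] <-] /=; rewrite cmapK// fg.
Qed.

Lemma partial_eq V c k x f g : open V -> V x -> cdom c x ->
  (forall y, V y -> f y = g y) -> partial c k f x = partial c k g x.
Proof.
by move=> oV Vx cx fg; apply: near_eq_derive; apply: (chart_near_eq oV) => // y /fg.
Qed.

Lemma smooth_derivable V c k x f : smooth_on A V f -> V x -> cdom c x ->
  derivable (f \o cinv c) (cmap c x) (delta_mx 0 k).
Proof.
move=> /smooth_onP/(_ c 1%N) Cf Vx cx; apply: (Ck_derivable Cf).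
by exists x.
Qed.

Lemma partial_cst c k x (a : R) : partial c k (fun=> a) x = 0.
Proof. exact: derive_cst. Qed.

Lemma partialD V c k x f g : smooth_on A V f -> smooth_on A V g ->
  V x -> cdom c x ->
  partial c k (fun y => f y + g y) x = partial c k f x + partial c k g x.
Proof.
by move=> sf sg Vx cx; rewrite /partial -deriveD//; exact: smooth_derivable Vx cx.
Qed.

Lemma partialM V c k x f g : smooth_on A V f -> smooth_on A V g ->
  V x -> cdom c x ->
  partial c k (fun y => f y * g y) x = f x * partial c k g x + g x * partial c k f x.
Proof.
move=> sf sg Vx cx.
rewrite /partial [LHS](deriveM (smooth_derivable sf Vx cx) (smooth_derivable sg Vx cx)).
by rewrite /= cmapK.
Qed.

Lemma partialN V c k x f : smooth_on A V f -> V x -> cdom c x ->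
  partial c k (fun y => - f y) x = - partial c k f x.
Proof. by move=> sf Vx cx; rewrite /partial -deriveN//; exact: smooth_derivable Vx cx. Qed.

Lemma partial_chain V c c' k x f : open V -> smooth_on A V f ->
  V x -> cdom c x -> cdom c' x ->
  partial c k f x =
  \sum_(l < d) partial c k (fun y => cmap c' y 0 l) x * partial c' l f x.
Proof.
move=> oV sf Vx cx c'x; pose g := cmap c' \o cinv c.
have oV' : open (V `&` cdom c') by apply: openI => //; exact: cdom_open.
have Cg n l : Ck n (cmap c @` ((V `&` cdom c') `&` cdom c)) (fun y => g y 0 l).
  by apply: transition_Ck; exact: subIsetr.
have icx : (cmap c @` ((V `&` cdom c') `&` cdom c)) (cmap c x) by exists x.
have := (@Ck_derivable_chain R d 0 (cmap c' @` (V `&` cdom c')) (f \o cinv c') _ g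
  (cmap c x) (delta_mx 0 k)).
case.
- exact: chart_image_open.
- by move/smooth_onP : sf; apply.
- by exists x => //; rewrite /g /= cmapK.
- by apply: for_continuous_row => l; exact: Ck_continuous (Cg 0%N l) icx.
- by move=> l; exact: (Ck_derivable (Cg 1%N l)).
move=> _ E; rewrite /partial.
have -> : 'D_(delta_mx 0 k) (f \o cinv c) (cmap c x) =
  'D_(delta_mx 0 k) ((f \o cinv c') \o g) (cmap c x).
  apply: near_eq_derive; apply: (chart_near_eq (V := V `&` cdom c') (g := f \o cinv c' \o cmap c')) => //.
  by move=> y [_ c'y] cy /=; rewrite cmapK.
by rewrite E; apply: eq_bigr => l _; rewrite /g /= cmapK.
Qed.

(** In another chart, the partial derivative with respect to the coordinates of
    [c] is a derivative of [f \o cinv c] composed with the transition map. *)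
Lemma smooth_partial V c k f : open V -> smooth_on A V f ->
  smooth_on A (V `&` cdom c) (partial c k f).
Proof.
move=> oV /smooth_onP sf; apply/smooth_onP => c' n.
have oVc : open (V `&` cdom c) by apply: openI => //; exact: cdom_open.
apply: (@Ck_comp R d d n (cmap c' @` ((V `&` cdom c) `&` cdom c'))
  (cmap c @` (V `&` cdom c)) ('D_(delta_mx 0 k) (f \o cinv c)) (cmap c \o cinv c')).
- exact: chart_image_open.
- exact: chart_image_open.
- by move=> _ [x [[Vx cx] c'x] <-]; rewrite /= cmapK//; exists x.
- exact: Ck_derive (sf c n.+1).
- by move=> l; apply: transition_Ck; exact: subIsetr.
Qed.

End Manifold.

(** ** Complex-valued functions *)

Local Open Scope complex_scope.

Section ComplexFunctions.
Context {R : realType} {d : nat} {M : topologicalType}.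
Variable A : smooth_atlas R d M.
Implicit Types (V W : set M) (f g : M -> R[i]) (c : chart A).

Lemma csmooth_on_sub V W f : W `<=` V -> csmooth_on A V f -> csmooth_on A W f.
Proof. by move=> WV [f1 f2]; split; apply: smooth_on_sub WV _. Qed.

Lemma csmooth_on_local V f :
  (forall x, V x -> exists2 W, W x & csmooth_on A W f) -> csmooth_on A V f.
Proof.
by move=> Vf; split; apply: smooth_on_local => x /Vf[W Wx [f1 f2]]; exists W.
Qed.

Lemma csmooth_on_eq V f g : open V -> (forall x, V x -> f x = g x) ->
  csmooth_on A V f -> csmooth_on A V g.
Proof.
by move=> oV fg [f1 f2]; split; [apply: smooth_on_eq f1|apply: smooth_on_eq f2] => // x /fg ->.
Qed.

Lemma csmooth_on_cst V (a : R[i]) : csmooth_on A V (fun=> a).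
Proof. by split; exact: smooth_on_cst. Qed.

Lemma csmooth_on_real V (f : M -> R) : smooth_on A V f ->
  csmooth_on A V (fun x => (f x)%:C).
Proof. by move=> sf; split; [exact: sf|exact: smooth_on_cst]. Qed.

Lemma complex_ReD (a b : R[i]) : complex.Re (a + b) = complex.Re a + complex.Re b.
Proof. by case: a; case: b. Qed.

Lemma complex_ImD (a b : R[i]) : complex.Im (a + b) = complex.Im a + complex.Im b.
Proof. by case: a; case: b. Qed.

Lemma complex_ReM (a b : R[i]) : complex.Re (a * b) =
  complex.Re a * complex.Re b + - (complex.Im a * complex.Im b).
Proof. by case: a; case: b. Qed.

Lemma complex_ImM (a b : R[i]) : complex.Im (a * b) =
  complex.Re a * complex.Im b + complex.Im a * complex.Re b.
Proof. by case: a; case: b. Qed.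

Lemma complex_ReV (a : R[i]) : complex.Re (a^-1) =
  complex.Re a * (complex.Re a * complex.Re a + complex.Im a * complex.Im a)^-1.
Proof. by case: a => a b; rewrite -!expr2. Qed.

Lemma complex_ImV (a : R[i]) : complex.Im (a^-1) =
  - (complex.Im a * (complex.Re a * complex.Re a + complex.Im a * complex.Im a)^-1).
Proof. by case: a => a b; rewrite -!expr2. Qed.

Lemma csmooth_onD V f g : open V -> csmooth_on A V f -> csmooth_on A V g ->
  csmooth_on A V (fun x => f x + g x).
Proof.
move=> oV [f1 f2] [g1 g2]; split.
  by apply: (smooth_on_eq oV _ (smooth_onD oV f1 g1)) => x _; rewrite complex_ReD.
by apply: (smooth_on_eq oV _ (smooth_onD oV f2 g2)) => x _; rewrite complex_ImD.
Qed.

Lemma csmooth_onM V f g : open V -> csmooth_on A V f -> csmooth_on A V g ->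
  csmooth_on A V (fun x => f x * g x).
Proof.
move=> oV [f1 f2] [g1 g2]; split.
  apply: (smooth_on_eq oV _ (smooth_onD oV (smooth_onM oV f1 g1)
    (smooth_onN oV (smooth_onM oV f2 g2)))) => x _; exact/esym/complex_ReM.
apply: (smooth_on_eq oV _ (smooth_onD oV (smooth_onM oV f1 g2)
  (smooth_onM oV f2 g1))) => x _; exact/esym/complex_ImM.
Qed.

Lemma csmooth_onV V f : open V -> (forall x, V x -> f x != 0) ->
  csmooth_on A V f -> csmooth_on A V (fun x => (f x)^-1).
Proof.
move=> oV f0 [f1 f2].
have sN := smooth_onD oV (smooth_onM oV f1 f1) (smooth_onM oV f2 f2).
have sV : smooth_on A V (fun x => (complex.Re (f x) * complex.Re (f x) +
                                  complex.Im (f x) * complex.Im (f x))^-1).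
  apply: smooth_onV => // x /f0; case: (f x) => a b /=.
  rewrite -!expr2; apply: contraNN; rewrite paddr_eq0 ?sqr_ge0// !sqrf_eq0.
  by move=> /andP[/eqP-> /eqP->].
split.
  apply: (smooth_on_eq oV _ (smooth_onM oV f1 sV)) => x _; exact/esym/complex_ReV.
apply: (smooth_on_eq oV _ (smooth_onN oV (smooth_onM oV f2 sV))) => x _.
exact/esym/complex_ImV.
Qed.

Lemma csmooth_on_sum V (I : Type) (r : seq I) (P : pred I) (F : I -> M -> R[i]) :
  open V -> (forall i, P i -> csmooth_on A V (F i)) ->
  csmooth_on A V (fun x => \sum_(i <- r | P i) F i x).
Proof.
move=> oV sF; elim: r => [|i r IH].
  by under eq_fun do rewrite big_nil; exact: csmooth_on_cst.
under eq_fun do rewrite big_cons.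
case: (P i) (sF i) => sFi; last exact: IH.
exact: (csmooth_onD oV (sFi isT) IH).
Qed.

Lemma csmooth_on_prod V (I : Type) (r : seq I) (P : pred I) (F : I -> M -> R[i]) :
  open V -> (forall i, P i -> csmooth_on A V (F i)) ->
  csmooth_on A V (fun x => \prod_(i <- r | P i) F i x).
Proof.
move=> oV sF; elim: r => [|i r IH].
  by under eq_fun do rewrite big_nil; exact: csmooth_on_cst.
under eq_fun do rewrite big_cons.
case: (P i) (sF i) => sFi; last exact: IH.
exact: (csmooth_onM oV (sFi isT) IH).
Qed.

Lemma csmooth_cpartial V c k f : open V -> csmooth_on A V f ->
  csmooth_on A (V `&` cdom c) (cpartial c k f).
Proof. by move=> oV [f1 f2]; split; exact: smooth_partial. Qed.

Lemma complexD_split (a b a' b' : R) : (a +i* b) + (a' +i* b') = (a + a') +i* (b + b').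
Proof. by []. Qed.

Lemma cpartial_eq V c k x f g : open V -> V x -> cdom c x ->
  (forall y, V y -> f y = g y) -> cpartial c k f x = cpartial c k g x.
Proof.
move=> oV Vx cx fg; congr Complex; apply: (partial_eq _ oV) => // y /fg -> //.
Qed.

Lemma cpartial_cst c k x (a : R[i]) : cpartial c k (fun=> a) x = 0.
Proof. by rewrite /cpartial !partial_cst. Qed.

Lemma cpartialD V c k x f g : csmooth_on A V f -> csmooth_on A V g ->
  V x -> cdom c x ->
  cpartial c k (fun y => f y + g y) x = cpartial c k f x + cpartial c k g x.
Proof.
move=> [f1 f2] [g1 g2] Vx cx; rewrite /cpartial complexD_split.
rewrite -(partialD _ f1 g1 Vx cx) -(partialD _ f2 g2 Vx cx).
have -> : (fun y => complex.Re (f y + g y)) =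
    (fun y => complex.Re (f y) + complex.Re (g y)).
  by apply/funext => y; exact: complex_ReD.
have -> // : (fun y => complex.Im (f y + g y)) =
    (fun y => complex.Im (f y) + complex.Im (g y)).
by apply/funext => y; exact: complex_ImD.
Qed.

Lemma cpartialM V c k x f g : open V -> csmooth_on A V f -> csmooth_on A V g ->
  V x -> cdom c x ->
  cpartial c k (fun y => f y * g y) x = cpartial c k f x * g x + f x * cpartial c k g x.
Proof.
move=> oV [f1 f2] [g1 g2] Vx cx; rewrite /cpartial.
have -> : (fun y => complex.Re (f y * g y)) = (fun y =>
    complex.Re (f y) * complex.Re (g y) + - (complex.Im (f y) * complex.Im (g y))).
  by apply/funext => y; exact: complex_ReM.
have -> : (fun y => complex.Im (f y * g y)) = (fun y =>
    complex.Re (f y) * complex.Im (g y) + complex.Im (f y) * complex.Re (g y)).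
  by apply/funext => y; exact: complex_ImM.
have sM a b (sa : smooth_on A V a) (sb : smooth_on A V b) := smooth_onM oV sa sb.
rewrite (partialD _ (sM _ _ f1 g1) (smooth_onN oV (sM _ _ f2 g2)) Vx cx).
rewrite (partialD _ (sM _ _ f1 g2) (sM _ _ f2 g1) Vx cx).
rewrite (partialN _ (sM _ _ f2 g2) Vx cx).
rewrite (partialM _ f1 g1 Vx cx) (partialM _ f2 g2 Vx cx).
rewrite (partialM _ f1 g2 Vx cx) (partialM _ f2 g1 Vx cx).
case: (f x) (g x) => [a b] [a' b'] /=.
apply/eqP; rewrite eq_complex /=; apply/andP; split; apply/eqP; ring.
Qed.

Lemma cpartial_sum V c k x (I : Type) (r : seq I) (F : I -> M -> R[i]) :
  open V -> (forall i, csmooth_on A V (F i)) -> V x -> cdom c x ->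
  cpartial c k (fun y => \sum_(i <- r) F i y) x = \sum_(i <- r) cpartial c k (F i) x.
Proof.
move=> oV sF Vx cx; elim: r => [|i r IH].
  by rewrite big_nil; under eq_fun do rewrite big_nil; exact: cpartial_cst.
rewrite big_cons -IH; under eq_fun do rewrite big_cons.
by rewrite (cpartialD _ (sF i) _ Vx cx)//; exact: csmooth_on_sum.
Qed.

Lemma cpartial_chain V c c' k x f : open V -> csmooth_on A V f ->
  V x -> cdom c x -> cdom c' x ->
  cpartial c k f x =
  \sum_(l < d) (partial c k (fun y => cmap c' y 0 l) x)%:C * cpartial c' l f x.
Proof.
move=> oV [f1 f2] Vx cx c'x; rewrite /cpartial.
rewrite (partial_chain k oV f1 Vx cx c'x) (partial_chain k oV f2 Vx cx c'x).
apply/eqP; rewrite eq_complex /= !raddf_sum /=; apply/andP.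
by split; apply/eqP/eq_bigr => l _ /=; rewrite !mul0r ?subr0 ?addr0.
Qed.

End ComplexFunctions.

(** ** Matrix-valued functions *)

Section MatrixFunctions.
Context {R : realType} {d : nat} {M : topologicalType}.
Variable A : smooth_atlas R d M.
Implicit Types (V W : set M) (c : chart A).

Lemma mxsmooth_on_sub p q V W (F : M -> 'M[R[i]]_(p, q)) :
  W `<=` V -> mxsmooth_on A V F -> mxsmooth_on A W F.
Proof. by move=> WV sF i j; exact: csmooth_on_sub WV (sF i j). Qed.

Lemma mxsmooth_on_local p q V (F : M -> 'M[R[i]]_(p, q)) :
  (forall x, V x -> exists2 W, W x & mxsmooth_on A W F) -> mxsmooth_on A V F.
Proof.
by move=> VF i j; apply: csmooth_on_local => x /VF[W Wx sF]; exists W.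
Qed.

Lemma mxsmooth_on_eq p q V (F G : M -> 'M[R[i]]_(p, q)) : open V ->
  (forall x, V x -> F x = G x) -> mxsmooth_on A V F -> mxsmooth_on A V G.
Proof.
move=> oV FG sF i j; apply: csmooth_on_eq oV _ (sF i j) => x Vx.
by rewrite FG.
Qed.

Lemma mxsmooth_on_cst p q V (F : 'M[R[i]]_(p, q)) : mxsmooth_on A V (fun=> F).
Proof. by move=> i j; exact: csmooth_on_cst. Qed.

Lemma mxsmooth_onD p q V (F G : M -> 'M[R[i]]_(p, q)) : open V ->
  mxsmooth_on A V F -> mxsmooth_on A V G -> mxsmooth_on A V (fun x => F x + G x).
Proof.
move=> oV sF sG i j; apply: csmooth_on_eq oV _ (csmooth_onD oV (sF i j) (sG i j)).
by move=> x Vx; rewrite mxE.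
Qed.

Lemma mxsmooth_onZ p q V (f : M -> R[i]) (F : M -> 'M[R[i]]_(p, q)) : open V ->
  csmooth_on A V f -> mxsmooth_on A V F -> mxsmooth_on A V (fun x => f x *: F x).
Proof.
move=> oV sf sF i j; apply: csmooth_on_eq oV _ (csmooth_onM oV sf (sF i j)).
by move=> x Vx; rewrite mxE.
Qed.

Lemma mxsmooth_on_sum p q V (I : Type) (r : seq I) (F : I -> M -> 'M[R[i]]_(p, q)) :
  open V -> (forall i, mxsmooth_on A V (F i)) ->
  mxsmooth_on A V (fun x => \sum_(i <- r) F i x).
Proof.
move=> oV sF; elim: r => [|i r IH].
  by under eq_fun do rewrite big_nil; exact: mxsmooth_on_cst.
under eq_fun do rewrite big_cons.
exact: (mxsmooth_onD oV (sF i) IH).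
Qed.

Lemma mxsmooth_onM p q r V (F : M -> 'M[R[i]]_(p, q)) (G : M -> 'M[R[i]]_(q, r)) :
  open V -> mxsmooth_on A V F -> mxsmooth_on A V G ->
  mxsmooth_on A V (fun x => F x *m G x).
Proof.
move=> oV sF sG i j.
have sS : csmooth_on A V (fun x => \sum_k F x i k * G x k j).
  by apply: csmooth_on_sum => // k _; exact: csmooth_onM.
by apply: csmooth_on_eq oV _ sS => x Vx; rewrite mxE.
Qed.

Lemma csmooth_det p V (F : M -> 'M[R[i]]_p) : open V -> mxsmooth_on A V F ->
  csmooth_on A V (fun x => \det (F x)).
Proof.
move=> oV sF; apply: (csmooth_on_sum _ oV) => s _.
apply: (csmooth_onM oV); first exact: csmooth_on_cst.
by apply: (csmooth_on_prod _ oV) => i _; exact: sF.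
Qed.

Lemma mxsmooth_invmx p V (F : M -> 'M[R[i]]_p) : open V ->
  (forall x, V x -> F x \in unitmx) -> mxsmooth_on A V F ->
  mxsmooth_on A V (fun x => invmx (F x)).
Proof.
move=> oV uF sF i j.
have sdet : csmooth_on A V (fun x => (\det (F x))^-1).
  apply: csmooth_onV oV _ (csmooth_det oV sF) => x Vx.
  by rewrite -unitfE -unitmxE; exact: uF.
have scof : csmooth_on A V (fun x => cofactor (F x) j i).
  apply: (csmooth_onM oV); first exact: csmooth_on_cst.
  apply: (csmooth_det oV) => i' j'.
  apply: csmooth_on_eq oV _ (sF (lift j i') (lift i j')) => x _.
  by rewrite !mxE.
apply: csmooth_on_eq oV _ (csmooth_onM oV sdet scof) => x Vx.
by rewrite /invmx uF// !mxE.
Qed.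

(** The derivative of [F] along the k-th coordinate vector field of [c]. *)
Definition dmx p q c (k : 'I_d) (F : M -> 'M[R[i]]_(p, q)) (x : M) :=
  \matrix_(i, j) cpartial c k (fun y => F y i j) x.

Lemma mxsmooth_dmx p q V c k (F : M -> 'M[R[i]]_(p, q)) : open V ->
  mxsmooth_on A V F -> mxsmooth_on A (V `&` cdom c) (dmx c k F).
Proof.
move=> oV sF i j; have oVc : open (V `&` cdom c) by apply: openI => //; exact: cdom_open.
apply: csmooth_on_eq oVc _ (csmooth_cpartial c k oV (sF i j)) => x _.
by rewrite mxE.
Qed.

Lemma dmx_eq p q V c k x (F G : M -> 'M[R[i]]_(p, q)) : open V -> V x -> cdom c x ->
  (forall y, V y -> F y = G y) -> dmx c k F x = dmx c k G x.
Proof.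
move=> oV Vx cx FG; apply/matrixP => i j; rewrite !mxE.
by apply: (cpartial_eq k oV Vx cx) => y Vy; rewrite FG.
Qed.

Lemma dmx_cst p q c k x (F : 'M[R[i]]_(p, q)) : dmx c k (fun=> F) x = 0.
Proof. by apply/matrixP => i j; rewrite !mxE cpartial_cst. Qed.

Lemma dmxD p q V c k x (F G : M -> 'M[R[i]]_(p, q)) :
  mxsmooth_on A V F -> mxsmooth_on A V G -> V x -> cdom c x ->
  dmx c k (fun y => F y + G y) x = dmx c k F x + dmx c k G x.
Proof.
move=> sF sG Vx cx; apply/matrixP => i j; rewrite !mxE.
have -> : (fun y => (F y + G y) i j) = (fun y => F y i j + G y i j).
  by apply/funext => y; rewrite mxE.
exact: cpartialD (sF i j) (sG i j) Vx cx.
Qed.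

Lemma dmxM p q r V c k x (F : M -> 'M[R[i]]_(p, q)) (G : M -> 'M[R[i]]_(q, r)) :
  open V -> mxsmooth_on A V F -> mxsmooth_on A V G -> V x -> cdom c x ->
  dmx c k (fun y => F y *m G y) x = dmx c k F x *m G x + F x *m dmx c k G x.
Proof.
move=> oV sF sG Vx cx; apply/matrixP => i j; rewrite !mxE.
have -> : (fun y => (F y *m G y) i j) = (fun y => \sum_l F y i l * G y l j).
  by apply/funext => y; rewrite mxE.
rewrite (cpartial_sum k _ oV _ Vx cx); last by move=> l; exact: csmooth_onM.
rewrite -big_split /=; apply: eq_bigr => l _; rewrite !mxE.
by rewrite (cpartialM k oV (sF i l) (sG l j) Vx cx).
Qed.

Lemma dmxZ p q V c k x (f : M -> R[i]) (F : M -> 'M[R[i]]_(p, q)) :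
  open V -> csmooth_on A V f -> mxsmooth_on A V F -> V x -> cdom c x ->
  dmx c k (fun y => f y *: F y) x = cpartial c k f x *: F x + f x *: dmx c k F x.
Proof.
move=> oV sf sF Vx cx; apply/matrixP => i j; rewrite !mxE.
have -> : (fun y => (f y *: F y) i j) = (fun y => f y * F y i j).
  by apply/funext => y; rewrite mxE.
exact: cpartialM oV sf (sF i j) Vx cx.
Qed.

Lemma dmx_chain p q V c c' k x (F : M -> 'M[R[i]]_(p, q)) : open V ->
  mxsmooth_on A V F -> V x -> cdom c x -> cdom c' x ->
  dmx c k F x =
  \sum_(l < d) (partial c k (fun y => cmap c' y 0 l) x)%:C *: dmx c' l F x.
Proof.
move=> oV sF Vx cx c'x; apply/matrixP => i j; rewrite summxE !mxE.
rewrite (cpartial_chain k oV (sF i j) Vx cx c'x).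
by apply: eq_bigr => l _; rewrite !mxE.
Qed.

End MatrixFunctions.

(** * Flat connections *)

Section FlatConnection.
Context {R : realType} {d : nat} {M : topologicalType}.
Variable A : smooth_atlas R d M.
Implicit Types (U V W : set M) (c : chart A).

(** The definition of a connection on [U] constrains [D s c x] only when [s] is
    smooth near [x]; elsewhere the value is set to [0]. *)
Definition germ_smooth p U (s : M -> 'cV[R[i]]_p) c x :=
  cdom c x /\ exists V, [/\ open V, V x, V `<=` U & mxsmooth_on A V s].

Lemma germ_smoothI p U V (s : M -> 'cV[R[i]]_p) c x :
  open V -> V `<=` U -> mxsmooth_on A V s -> V x -> cdom c x -> germ_smooth U s c x.
Proof. by move=> oV VU sV Vx cx; split=> //; exists V. Qed.

(** The connection for which the columns of [Phi] are parallel. *)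
Definition flat_conn p U (Phi : M -> 'M[R[i]]_p) : cov_op A p :=
  fun s c x k => if `[< germ_smooth U s c x >]
    then Phi x *m dmx c k (fun y => invmx (Phi y) *m s y) x else 0.

Lemma flat_connE p U (Phi : M -> 'M[R[i]]_p) V s c x k :
  open V -> V `<=` U -> mxsmooth_on A V s -> V x -> cdom c x ->
  flat_conn U Phi s c x k = Phi x *m dmx c k (fun y => invmx (Phi y) *m s y) x.
Proof. by move=> oV VU sV Vx cx; rewrite /flat_conn asboolT//; exact: germ_smoothI sV Vx cx. Qed.

Variables (p : nat) (U : set M) (Phi : M -> 'M[R[i]]_p).
Hypothesis Phi_smooth : mxsmooth_on A U Phi.
Hypothesis Phi_unit : forall x, U x -> Phi x \in unitmx.

Let sInv V : open V -> V `<=` U -> mxsmooth_on A V (fun x => invmx (Phi x)).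
Proof.
move=> oV VU; apply: mxsmooth_invmx => //; first by move=> x /VU; exact: Phi_unit.
exact: mxsmooth_on_sub VU Phi_smooth.
Qed.

Let sInvs V (s : M -> 'cV[R[i]]_p) : open V -> V `<=` U -> mxsmooth_on A V s ->
  mxsmooth_on A V (fun x => invmx (Phi x) *m s x).
Proof. by move=> oV VU; apply: mxsmooth_onM => //; exact: sInv. Qed.

Lemma flat_connection : connection U (flat_conn U Phi).
Proof.
split.
- move=> V s oV VU sV; split=> [c k|c c' x k Vx cx c'x].
    have oVc : open (V `&` cdom c) by apply: openI => //; exact: cdom_open.
    apply: (@mxsmooth_on_eq _ _ _ _ _ _ (V `&` cdom c)
      (fun x => Phi x *m dmx c k (fun y => invmx (Phi y) *m s y) x)) => //.
      by move=> x [Vx cx]; rewrite (flat_connE _ k oV VU sV Vx cx).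
    apply: mxsmooth_onM => //.
      by apply: mxsmooth_on_sub Phi_smooth; apply: subset_trans VU; exact: subIsetl.
    exact: mxsmooth_dmx oV (sInvs oV VU sV).
  rewrite (flat_connE _ k oV VU sV Vx cx).
  rewrite (dmx_chain k oV (sInvs oV VU sV) Vx cx c'x) mulmx_sumr.
  by apply: eq_bigr => l _; rewrite -scalemxAr (flat_connE _ l oV VU sV Vx c'x).
- move=> V s t oV VU sV tV c x k Vx cx.
  rewrite (flat_connE _ k oV VU sV Vx cx) (flat_connE _ k oV VU tV Vx cx).
  rewrite (flat_connE _ k oV VU (mxsmooth_onD oV sV tV) Vx cx) -mulmxDr; congr (_ *m _).
  have -> : (fun y => invmx (Phi y) *m (s y + t y)) =
      (fun y => invmx (Phi y) *m s y + invmx (Phi y) *m t y).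
    by apply/funext => y; rewrite mulmxDr.
  exact: dmxD (sInvs oV VU sV) (sInvs oV VU tV) Vx cx.
- move=> V f s oV VU fV sV c x k Vx cx.
  rewrite (flat_connE _ k oV VU sV Vx cx).
  rewrite (flat_connE _ k oV VU (mxsmooth_onZ oV fV sV) Vx cx).
  under eq_fun do rewrite -scalemxAr.
  rewrite (dmxZ k oV fV (sInvs oV VU sV) Vx cx) mulmxDr -!scalemxAr mulmxA.
  by rewrite mulmxV ?mul1mx//; apply/Phi_unit/VU.
- by move=> s c x k ngs; rewrite /flat_conn asboolF.
Qed.

(** Expanding [d s = d (Phi Phi^-1 s)] gives [Phi d (Phi^-1 s) = d s + omega s]
    with this [omega]. *)
Definition flat_form c k x : 'M[R[i]]_p := - (dmx c k Phi x *m invmx (Phi x)).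

Lemma flat_formE V s c x k :
  open V -> V `<=` U -> mxsmooth_on A V s -> V x -> cdom c x ->
  flat_conn U Phi s c x k = dmx c k s x + flat_form c k x *m s x.
Proof.
move=> oV VU sV Vx cx; rewrite (flat_connE _ k oV VU sV Vx cx).
have uPhi := Phi_unit (VU _ Vx).
have sPhi := mxsmooth_on_sub VU Phi_smooth.
have E := dmxM k oV sPhi (sInvs oV VU sV) Vx cx.
have -> : dmx c k s x = dmx c k (fun y => Phi y *m (invmx (Phi y) *m s y)) x.
  apply: (dmx_eq k oV Vx cx) => y Vy.
  by rewrite mulmxA mulmxV ?mul1mx//; apply/Phi_unit/VU.
by rewrite E /flat_form mulNmx mulmxA addrAC subrr add0r.
Qed.

Lemma flat_form_mul x c k : U x -> flat_form c k x *m Phi x = - dmx c k Phi x.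
Proof. by move=> Ux; rewrite mulNmx mulmxKV//; exact: Phi_unit. Qed.

End FlatConnection.

(** * The category of matrices of vector spaces *)

Section MatrixCategory.
Variables (n : nat) (C : fieldType).
Implicit Types (E F G : vobj n).

Section Positions.
Variables (E F : vobj n) (i k : 'I_n).

(** The basis vector labelled [(j, a, b)] in the [(i, k)] entry, which is the
    direct sum over [j] of the tensor products of [E i j] and [F j k]. *)
Definition vpos (j : 'I_n) (a : 'I_(E i j)) (b : 'I_(F j k)) :
    'I_(vobj_mul E F i k) :=
  @tagnat.Rank n (fun j => E i j * F j k)%N j (mxtens_index (a, b)).

Variant is_vpos : 'I_(vobj_mul E F i k) -> Prop :=
  IsVpos j a b : is_vpos (@vpos j a b).

Lemma vposP r : is_vpos r.
Proof.
rewrite -[r](@tagnat.sig2K n (fun j => E i j * F j k)%N).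
by case: (mxtens_indexP (tagnat.sig2 r)) => a b; exact: IsVpos.
Qed.

Lemma vpos_eqn j a b j' a' b' : (@vpos j a b == @vpos j' a' b' :> nat) =
  [&& j == j', a == a' :> nat & b == b' :> nat].
Proof.
rewrite [LHS]tagnat.eq_Rank; case: eqP => //= jj'.
case: _ / jj' in a' b' *.
transitivity (mxtens_index (a, b) == mxtens_index (a', b')); first by [].
by rewrite (can_eq (@mxtens_indexK _ _)) xpair_eqE.
Qed.

Lemma vpos_eq j a b j' a' b' : (@vpos j a b == @vpos j' a' b') =
  [&& j == j', a == a' :> nat & b == b' :> nat].
Proof. by rewrite -vpos_eqn. Qed.

End Positions.

Lemma mxblock_Rank (p q : nat) (p_ : 'I_p -> nat) (q_ : 'I_q -> nat)
    (B : forall i j, 'M[C]_(p_ i, q_ j)) i j u v :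
  (\mxblock_(i, j) B i j) (tagnat.Rank i u) (tagnat.Rank j v) = B i j u v.
Proof. by have /matrixP/(_ u v) := mxblockK B i j; rewrite mxE. Qed.

Lemma vhom_mulE E E' F F' (f : vhom C E E') (g : vhom C F F') i k j a b a' b' :
  vhom_mul f g i k (@vpos E' F' i k j a b) (@vpos E F i k j a' b') =
  f i j a a' * g j k b b'.
Proof. by rewrite mxblock_Rank eqxx conform_mx_id tensmxE. Qed.

Lemma submxcol_vhom_mul E F (f : vhom C E E) (g : vhom C F F) i k m
    (v : 'M[C]_(vobj_mul E F i k, m)) j :
  submxcol (vhom_mul f g i k *m v) j =
  tensmx (f i j) (g j k) *m submxcol v j.
Proof.
have -> : vhom_mul f g i k = \mxdiag_j tensmx (f i j) (g j k) by [].
by rewrite -[v in LHS](@submxcolK _ _ (fun j => E i j * F j k)%N)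
           mul_mxdiag_mxcol mxcolK.
Qed.

Lemma vhom_mul_neq E E' F F' (f : vhom C E E') (g : vhom C F F')
    i k j a b j' a' b' : j != j' ->
  vhom_mul f g i k (@vpos E' F' i k j a b) (@vpos E F i k j' a' b') = 0.
Proof. by move=> jj'; rewrite mxblock_Rank (negbTE jj') mxE. Qed.

Lemma vhomP E F (f g : vhom C E F) : (forall i j, f i j = g i j) -> f = g.
Proof. by move=> fg; apply: functional_extensionality_dep => i;
  apply: functional_extensionality_dep => j. Qed.

Lemma vhom_compA E F G H (h : vhom C G H) (g : vhom C F G) (f : vhom C E F) :
  vhom_comp h (vhom_comp g f) = vhom_comp (vhom_comp h g) f.
Proof. by apply: vhomP => i j; rewrite /vhom_comp mulmxA. Qed.

Lemma vhom_idE E i j : @vhom_id n C E E i j = 1%:M.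
Proof. by apply/matrixP => r s; rewrite !mxE val_eqE. Qed.

Lemma vhom_id_comp E F (f : vhom C E F) : vhom_comp (@vhom_id n C F F) f = f.
Proof. by apply: vhomP => i j; rewrite /vhom_comp vhom_idE mul1mx. Qed.

Lemma vhom_comp_id E F (f : vhom C E F) : vhom_comp f (@vhom_id n C E E) = f.
Proof. by apply: vhomP => i j; rewrite /vhom_comp vhom_idE mulmx1. Qed.

Lemma vhom_mul_comp E E' E'' F F' F'' (f' : vhom C E' E'') (f : vhom C E E')
    (g' : vhom C F' F'') (g : vhom C F F') :
  vhom_mul (vhom_comp f' f) (vhom_comp g' g) =
  vhom_comp (vhom_mul f' g') (vhom_mul f g).
Proof.
apply: vhomP => i k; rewrite /vhom_comp /vhom_mul mul_mxblock.
apply: eq_mxblock => j j'; case: (eqVneq j j') => [->|jj'].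
  rewrite (bigD1 j') //= eqxx !conform_mx_id tensmx_mul big1 ?addr0// => l lj'.
  by rewrite eq_sym (negbTE lj') mul0mx.
rewrite big1// => l _; case: (eqVneq j l) => [<-|]; last by rewrite mul0mx.
by rewrite (negbTE jj') mulmx0.
Qed.

Lemma vhom_mul_id E F : vhom_mul (@vhom_id n C E E) (@vhom_id n C F F) =
  @vhom_id n C (vobj_mul E F) (vobj_mul E F).
Proof.
apply: vhomP => i k; rewrite vhom_idE; apply/matrixP => r s.
case: (vposP r) => j a b; case: (vposP s) => j' a' b'.
rewrite [RHS]mxE vpos_eq; case: (eqVneq j j') => [jj'|jj'] /=; last first.
  by rewrite vhom_mul_neq.
case: _ / jj' in a' b' *; rewrite vhom_mulE !mxE -natrM mulnb.
by [].
Qed.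

Lemma vassocE E F G i l k j a b c j' k' a' b' c' :
  @vassoc n C E F G i l (@vpos (vobj_mul E F) G i l k (@vpos E F i k j a b) c)
    (@vpos E (vobj_mul F G) i l j' a' (@vpos F G j' l k' b' c')) =
  [&& j == j', k == k', a == a' :> nat, b == b' :> nat & c == c' :> nat]%:R.
Proof.
rewrite mxE /tagnat.sig1 /tagnat.sig2 /vpos /tagnat.Rank !tagnat.rankK.
rewrite !mxtens_indexK.
by rewrite !tagnat.rankK !mxtens_indexK.
Qed.

Lemma sum_indicator (I : finType) (P : I -> bool) (i0 : I) (f : I -> C) :
  (forall i, P i = (i == i0)) -> \sum_i (P i)%:R * f i = f i0.
Proof.
move=> PE; rewrite (bigD1 i0)//= PE eqxx mul1r big1 ?addr0// => i ii0.
by rewrite PE (negbTE ii0) mul0r.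
Qed.

(** The associator only relabels basis vectors, and the entry of either product
    of three morphisms at a pair of labels is the product of the entries of [f],
    [g] and [h], or [0] if the labels [j] or [k] differ. *)
Lemma vassoc_natural E E' F F' G G' (f : vhom C E E') (g : vhom C F F')
    (h : vhom C G G') :
  vhom_comp (@vassoc n C E' F' G') (vhom_mul f (vhom_mul g h)) =
  vhom_comp (vhom_mul (vhom_mul f g) h) (@vassoc n C E F G).
Proof.
apply: vhomP => i l; apply/matrixP => r s.
case: (vposP r) => k u c; case: (vposP u) => j a b {r u}.
case: (vposP s) => j' a' v; case: (vposP v) => k' b' c' {s v}.
rewrite !mxE.
transitivity (vhom_mul f (vhom_mul g h) i l
  (vpos a (vpos b c)) (vpos a' (vpos b' c'))).
  rewrite -(@sum_indicator _ (fun t => t == vpos a (vpos b c)) (vpos a (vpos b c))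
    (fun t => vhom_mul f (vhom_mul g h) i l t (vpos a' (vpos b' c'))))//.
  apply: eq_bigr => t _; congr (_ * _).
  case: (vposP t) => j1 a1 v; case: (vposP v) => k1 b1 c1.
  rewrite vassocE !vpos_eq; congr (_%:R).
  rewrite (eq_sym j) (eq_sym k) (eq_sym (nat_of_ord a)) (eq_sym (nat_of_ord b)).
  rewrite (eq_sym (nat_of_ord c)).
  case: (eqVneq j1 j) => //= jj; case: _ / jj in a b *.
  by rewrite vpos_eqn andbCA.
transitivity (vhom_mul (vhom_mul f g) h i l
  (vpos (vpos a b) c) (vpos (vpos a' b') c')).
  case: (eqVneq j j') => [jj|jj]; last first.
    rewrite vhom_mul_neq//; case: (eqVneq k k') => [kk|kk]; last by rewrite vhom_mul_neq.
    by case: _ / kk in b' c' *; rewrite vhom_mulE vhom_mul_neq// mul0r.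
  case: _ / jj in a' b' *; rewrite vhom_mulE.
  case: (eqVneq k k') => [kk|kk]; last by rewrite !vhom_mul_neq// mulr0.
  by case: _ / kk in b' c' *; rewrite !vhom_mulE mulrA.
rewrite -(@sum_indicator _ (fun t => t == vpos (vpos a' b') c') (vpos (vpos a' b') c')
  (fun t => vhom_mul (vhom_mul f g) h i l (vpos (vpos a b) c) t))//.
apply: eq_bigr => t _; rewrite mulrC; congr (_ * _).
case: (vposP t) => k1 v c1; case: (vposP v) => j1 a1 b1.
rewrite vassocE !vpos_eq; congr (_%:R).
case: (eqVneq k1 k') => [kk|kk]; last by rewrite !andbF.
by case: _ / kk in b' c' *; rewrite vpos_eqn -!andbA.
Qed.

End MatrixCategory.

Section UnitMorphisms.
Variables (n : nat) (C : fieldType).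
Implicit Types (E F G : vobj n).

(** Automorphisms of [E]. *)
Definition vunit E (f : vhom C E E) := forall i j, f i j \in unitmx.

Lemma vunit_mul E F (f : vhom C E E) (g : vhom C F F) :
  vunit f -> vunit g -> vunit (vhom_mul f g).
Proof.
move=> uf ug i k.
have : vhom_comp (vhom_mul f g)
    (vhom_mul (fun i j => invmx (f i j)) (fun i j => invmx (g i j))) =
    @vhom_id n C _ _.
  rewrite -vhom_mul_comp -vhom_mul_id; congr vhom_mul; apply: vhomP => i' j';
    by rewrite /vhom_comp mulmxV ?vhom_idE.
move=> /(congr1 (fun h => h i k)); rewrite vhom_idE /vhom_comp.
by case/mulmx1_unit.
Qed.

Lemma vunit_id E : vunit (@vhom_id n C E E).
Proof. by move=> i j; rewrite vhom_idE unitmx1. Qed.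

Lemma vobjP E F : E =2 F -> E = F.
Proof. by move=> EF; apply/funext => i; apply/funext => j. Qed.

Lemma vhom_id_cancel E F : E =2 F ->
  vhom_comp (@vhom_id n C F E) (@vhom_id n C E F) = @vhom_id n C E E.
Proof. by move=> /vobjP ->; exact: vhom_id_comp. Qed.

(** [vhom_id F E] is invertible because [E] and [F] are equal as functions. *)
Lemma vunit_transport E F (phi : vhom C E F) (f : vhom C E E) : E =2 F ->
  vhom_iso phi -> vunit f -> vunit (vhom_comp phi (vhom_comp f (@vhom_id n C F E))).
Proof.
move=> /vobjP EF; case: _ / EF in phi * => iphi uf i j.
rewrite vhom_comp_id /vhom_comp unitmx_mul uf andbT -row_free_unit.
by have /andP[] := iphi i j.
Qed.

End UnitMorphisms.

Section SmoothMorphisms.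
Context {R : realType} {d : nat} {M : topologicalType}.
Variables (A : smooth_atlas R d M) (n : nat).

Lemma mxsmooth_vhom_mul V (E E' F F' : vobj n) (f : M -> vhom R[i] E E')
    (g : M -> vhom R[i] F F') : open V ->
  (forall i j, mxsmooth_on A V (fun x => f x i j)) ->
  (forall i j, mxsmooth_on A V (fun x => g x i j)) ->
  forall i k, mxsmooth_on A V (fun x => vhom_mul (f x) (g x) i k).
Proof.
move=> oV sf sg i k r s; case: (vposP r) => j a b; case: (vposP s) => j' a' b'.
case: (eqVneq j j') => [jj|jj]; last first.
  by under eq_fun do rewrite vhom_mul_neq//; exact: csmooth_on_cst.
case: _ / jj in a' b' *; under eq_fun do rewrite vhom_mulE.
exact: (csmooth_onM oV (sf i j a a') (sg j k b b')).
Qed.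

End SmoothMorphisms.

(** * Frames over a chain of indices *)

Section Frames.
Context {R : realType} {d : nat} {M : topologicalType}.
Variables (A : smooth_atlas R d M) (n : nat).
Context {disp : Order.disp_t} {J : porderType disp}.
Variable E : charted_2vb A n J.

Local Notation vid X Y := (@vhom_id n R[i] X Y).

(** The columns of [Phi a b] form a frame of [E^{ab}], and [P] is the matrix of
    the coherency map in the product frame and the frame of [E^{ac}]. *)
Definition constant_frames (s : seq J) (W : set M)
    (Phi : forall a b, M -> vhom R[i] (obj E a b) (obj E a b)) :=
  [/\ forall a b, a \in s -> b \in s -> (a < b)%O ->
        forall i j, mxsmooth_on A W (fun x => Phi a b x i j),
      forall a b, a \in s -> b \in s -> (a < b)%O ->
        forall x, W x -> vunit (Phi a b x)
    & forall a b c, a \in s -> b \in s -> c \in s -> (a < b)%O -> (b < c)%O ->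
        exists P : vhom R[i] (vobj_mul (obj E a b) (obj E b c)) (obj E a c),
        forall x, W x ->
          vhom_comp (coh E a b c x) (vhom_mul (Phi a b x) (Phi b c x)) =
          vhom_comp (Phi a c x) P].

(** Induction on the chain [s], which is listed from the top. Let [c] be the new
    top element and [e] the one below it. The bundle [E^{ec}] gets the standard
    frame, and for [a < e] the coherency map transports the product of the frames
    of [E^{ae}] and [E^{ec}] to [E^{ac}]. So the coherency map for [a < e < c] is
    constant by construction. For [a < b < e < c], coherence gives,
    up to associators,
[[
      phi^{abc} (Phi^{ab} . Phi^{bc})
        = phi^{abc} (id . phi^{bec}) (Phi^{ab} . Phi^{be} . id)
        = phi^{aec} (phi^{abe} (Phi^{ab} . Phi^{be}) . id)
        = phi^{aec} (Phi^{ae} P . id) = Phi^{ac} (P . id)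
]]
    with [P] constant by the induction hypothesis for [a < b < e]. *)
Lemma chain_frames (s : seq J) (W : set M) : open W -> pairwise >%O s ->
  (forall a, a \in s -> W `<=` cov E a) ->
  exists Phi, constant_frames s W Phi.
Proof.
move=> oW; elim: s => [|c s IH].
  by exists (fun a b x => vid _ _); split.
case: s IH => [|e s] IH ss sW.
  exists (fun a b x => vid _ _).
  have cc a b : a \in [:: c] -> b \in [:: c] -> (a < b)%O = false.
    by rewrite !inE => /eqP-> /eqP->; rewrite ltxx.
  by split=> [a b /cc cb /cb->|a b /cc cb /cb->|a b f /cc cb /cb->].
set t := e :: s in IH ss sW *.
have := ss; rewrite pairwise_cons => /andP[/allP tc st].
have := st; rewrite pairwise_cons => /andP[/allP se _].
have [a ta|Phi [sPhi uPhi cPhi]] := IH st.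
  by apply: sW; rewrite inE ta orbT.
have et : e \in t by rewrite inE eqxx.
have ec : (e < c)%O by exact: tc.
have cN a : a \in t -> (a == c) = false.
  by move=> /tc ac; apply/negbTE; rewrite lt_eqF.
have Wt a : a \in t -> W `<=` cov E a by move=> ta; apply: sW; rewrite inE ta orbT.
have Wc : W `<=` cov E c by apply: sW; rewrite inE eqxx.
have lte a : a \in t -> (a == e) = false -> (a < e)%O.
  by rewrite inE => /orP[->//|/se].
(* [obj_mul] identifies [E^{ab}] with [E^{ae} . E^{eb}] only pointwise, so the
   identity between the two objects makes [Psi a b] an endomorphism. *)
pose Psi a b x : vhom R[i] (obj E a b) (obj E a b) :=
  vhom_comp (coh E a e b x)
    (vhom_comp (vhom_mul (Phi a e x) (vid (obj E e b) (obj E e b)))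
               (vid (obj E a b) (vobj_mul (obj E a e) (obj E e b)))).
pose Phi' a b x := if b == c then
    if a == e then vid (obj E a b) (obj E a b) else Psi a b x
  else Phi a b x.
have below a b : a \in c :: t -> b \in c :: t -> (a < b)%O -> a \in t.
  rewrite ![_ \in c :: t]inE => /orP[/eqP->|//] /orP[/eqP->|].
    by rewrite ltxx.
  by move=> /tc bc cb; have := lt_trans cb bc; rewrite ltxx.
have cases b : b \in c :: t -> b = c \/ b \in t.
  by rewrite inE => /orP[/eqP|]; [left|right].
(* Precomposing with the reverse identification leaves the transported frame. *)
have Psi_cancel a x : a \in t -> (a < e)%O ->
    vhom_comp (Psi a c x) (vid (vobj_mul (obj E a e) (obj E e c)) _) =
    vhom_comp (coh E a e c x) (vhom_mul (Phi a e x) (vid (obj E e c) (obj E e c))).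
  move=> ta ae; rewrite /Psi -!vhom_compA (vhom_id_cancel R[i]) ?vhom_comp_id//.
  exact: obj_mul.
exists Phi'; split.
- move=> a b /below ab /cases bt /[dup] altb /ab {}ab i j.
  have ta : a \in t by apply: ab; case: bt => [->|bt]; rewrite inE ?eqxx ?bt ?orbT.
  rewrite /Phi'; case: bt => [->|bt]; last first.
    by rewrite (cN b bt); exact: sPhi.
  rewrite eqxx; case: (boolP (a == e)) => [_|/negbTE ae]; first exact: mxsmooth_on_cst.
  have {}ae := lte _ ta ae.
  apply: mxsmooth_onM => //.
    apply: (mxsmooth_on_sub _ (@coh_smooth _ _ _ _ _ _ _ E a e c i j ae ec)).
    by move=> x Wx; split; [split; exact: Wt|exact: Wc].
  apply: mxsmooth_onM => //; last exact: mxsmooth_on_cst.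
  apply: mxsmooth_vhom_mul => // [i' j'|i' j']; first exact: sPhi.
  exact: mxsmooth_on_cst.
- move=> a b /below ab /cases bt /[dup] altb /ab {}ab x Wx.
  have ta : a \in t by apply: ab; case: bt => [->|bt]; rewrite inE ?eqxx ?bt ?orbT.
  rewrite /Phi'; case: bt => [->|bt]; last first.
    by rewrite (cN b bt); exact: uPhi.
  rewrite eqxx; case: (boolP (a == e)) => [_|/negbTE ae]; first exact: vunit_id.
  have {}ae := lte _ ta ae.
  apply: vunit_transport.
  + exact: obj_mul.
  + by apply: coh_iso => //; split; [split; exact: Wt|exact: Wc].
  + by apply: vunit_mul; [exact: uPhi|exact: vunit_id].
move=> a b f /below af /below bf /cases ft ab bf'.
have tb : b \in t by apply: bf bf'; case: ft => [->|ft]; rewrite inE ?eqxx ?ft ?orbT.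
have ta : a \in t by apply: af ab; rewrite inE tb orbT.
rewrite /Phi' (cN b tb); case: ft => [fc|ft]; last first.
  by rewrite (cN f ft); exact: cPhi.
move: bf'; rewrite {}fc eqxx => bc {af bf}.
have ae : (a < e)%O.
  by case: (boolP (b == e)) => [/eqP <-//|/negbTE/(lte _ tb)]; exact: lt_trans.
rewrite (lt_eqF ae).
case: (eqVneq b e) => [be|/negbTE /(lte _ tb) be].
  case: _ / (esym be) in tb bc ab *.
  exists (vid (vobj_mul (obj E a e) (obj E e c)) (obj E a c)) => x Wx.
  by rewrite Psi_cancel.
have [P HP] := cPhi _ _ _ ta tb et ab be.
(* The matrix [P . id], up to the associator and the identifications of
   objects. *)
exists (vhom_comp (vid (vobj_mul (obj E a e) (obj E e c)) (obj E a c))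
  (vhom_comp (vhom_mul P (vid (obj E e c) (obj E e c)))
   (vhom_comp (vassoc R[i] (obj E a b) (obj E b e) (obj E e c))
     (vhom_mul (vid (obj E a b) (obj E a b))
       (vid (obj E b c) (vobj_mul (obj E b e) (obj E e c))))))) => x Wx.
rewrite vhom_compA Psi_cancel//.
have asc : vhom_comp (coh E a b c x)
     (vhom_mul (vid (obj E a b) (obj E a b)) (coh E b e c x)) =
   vhom_comp (coh E a e c x) (vhom_comp
     (vhom_mul (coh E a b e x) (vid (obj E e c) (obj E e c)))
     (vassoc R[i] (obj E a b) (obj E b e) (obj E e c))).
  apply: vhomP => i j; apply: coh_assoc => //.
  by split; [split; [split|]|]; [exact: Wt|exact: Wt|exact: Wt|exact: Wc].
(* Writing [Phi a b x] as a composite with identities lets [vhom_mul_comp] separate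
   the coherency maps from the frames. *)
rewrite -[in LHS](vhom_id_comp (Phi a b x)) -[in LHS](vhom_comp_id (Phi a b x)).
rewrite !vhom_mul_comp !vhom_compA asc.
rewrite -!vhom_compA; congr vhom_comp; rewrite !vhom_compA; congr vhom_comp.
rewrite -[LHS]vhom_compA vassoc_natural !vhom_compA -!vhom_mul_comp HP//.
Qed.

End Frames.

(** * Products of flat connections *)

Section FlatProduct.
Context {R : realType} {d : nat} {M : topologicalType}.
Variable A : smooth_atlas R d M.
Implicit Types (U V W : set M) (c : chart A).

Lemma tens_cvE p q (u : 'cV[R[i]]_p) (v : 'cV[R[i]]_q) a b :
  tens_cv u v (mxtens_index (a, b)) 0 = u a 0 * v b 0.
Proof. by rewrite mxE mxtens_indexK /= !ord1. Qed.

Lemma mxtens_sum (S : nmodType) p q (f : 'I_(p * q) -> S) :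
  \sum_t f t = \sum_a \sum_b f (mxtens_index (a, b)).
Proof.
rewrite pair_big /= (reindex (fun u : 'I_p * 'I_q => mxtens_index u)) /=.
  by apply: eq_bigr => -[].
by exists (@mxtens_unindex p q) => u _; rewrite (mxtens_indexK, mxtens_unindexK).
Qed.

(** The slice [s_b] contributes [(d s_b + omega s_b) (x) e_b] and
    [s_b (x) omega' e_b], the constant section [e_b] having derivative [0]. *)
Lemma conn_tens_flat p q U U' (Phi : M -> 'M[R[i]]_p) (Phi' : M -> 'M[R[i]]_q)
    V (s : M -> 'cV[R[i]]_(p * q)) c x k :
  mxsmooth_on A U Phi -> (forall y, U y -> Phi y \in unitmx) ->
  mxsmooth_on A U' Phi' -> (forall y, U' y -> Phi' y \in unitmx) ->
  open V -> V `<=` U -> V `<=` U' -> mxsmooth_on A V s -> V x -> cdom c x ->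
  conn_tens (flat_conn U Phi) (flat_conn U' Phi') s c x k =
  dmx c k s x + (tensmx (flat_form Phi c k x) 1%:M
               + tensmx 1%:M (flat_form Phi' c k x)) *m s x.
Proof.
move=> sP uP sP' uP' oV VU VU' sV Vx cx; apply/matrixP => t z; rewrite (ord1 z) {z}.
case: (mxtens_indexP t) => a b {t}.
have sslice b' : mxsmooth_on A V (fun y => \col_a s y (mxtens_index (a, b')) 0).
  move=> a' z; apply: csmooth_on_eq oV _ (sV (mxtens_index (a', b')) 0) => y _.
  by rewrite mxE.
rewrite summxE.
under eq_bigr => b' _.
  rewrite mxE !tens_cvE.
  rewrite (flat_formE sP uP k oV VU (sslice b') Vx cx).
  rewrite (flat_formE sP' uP' k oV VU' (mxsmooth_on_cst A V (delta_mx b' 0)) Vx cx).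
  rewrite dmx_cst add0r -colE.
  over.
rewrite big_split /= (bigD1 b)//= big1 ?addr0; last first.
  by move=> b' bb'; rewrite [delta_mx _ _ _ _]mxE eq_sym (negbTE bb') mulr0.
rewrite [delta_mx _ _ _ _]mxE !eqxx mulr1.
rewrite [X in X + _]mxE [RHS]mxE -addrA; congr (_ + _).
  rewrite [LHS]mxE [RHS]mxE; congr (cpartial _ _ _ _).
  by apply/funext => y; rewrite mxE.
move: (flat_form Phi c k x) (flat_form Phi' c k x) => om om'.
rewrite !mxE mxtens_sum.
under [RHS]eq_bigr => a' _ do under eq_bigr => b' _ do
  rewrite mxE !tensmxE !mxE mulrDl.
under [RHS]eq_bigr => a' _ do rewrite big_split /=.
rewrite big_split /=; congr (_ + _).
  apply: eq_bigr => a' _; rewrite (bigD1 b)//= eqxx mulr1 mxE big1 ?addr0// => b' bb'.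
  by rewrite eq_sym (negbTE bb') mulr0 mul0r.
rewrite (bigD1 a)//= [X in _ + X]big1 ?addr0; last first.
  by move=> a' aa'; rewrite big1// => b' _; rewrite eq_sym (negbTE aa') !mul0r.
by apply: eq_bigr => b' _; rewrite eqxx mul1r !mxE mulrC.
Qed.

Section Product.
Variables (n : nat) (E F : vobj n).

Lemma dmx_vhom_mul (f : M -> vhom R[i] E E) (g : M -> vhom R[i] F F) V c x k i l :
  open V -> (forall i j, mxsmooth_on A V (fun x => f x i j)) ->
  (forall i j, mxsmooth_on A V (fun x => g x i j)) -> V x -> cdom c x ->
  dmx c k (fun y => vhom_mul (f y) (g y) i l) x =
  vhom_mul ((fun i j => dmx c k (fun y => f y i j) x) : vhom R[i] E E) (g x) i l +
  vhom_mul (f x) ((fun i j => dmx c k (fun y => g y i j) x) : vhom R[i] F F) i l.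
Proof.
move=> oV sf sg Vx cx; apply/matrixP => r s.
case: (vposP r) => j a b; case: (vposP s) => j' a' b'; rewrite [LHS]mxE [RHS]mxE.
case: (eqVneq j j') => [jj|jj]; last first.
  rewrite [X in _ = X + _]vhom_mul_neq// [X in _ = _ + X]vhom_mul_neq// addr0.
  have -> : (fun y => vhom_mul (f y) (g y) i l (vpos a b) (vpos a' b')) = (fun=> 0).
    by apply/funext => y; exact: vhom_mul_neq.
  exact: cpartial_cst.
case: _ / jj in a' b' *.
rewrite [X in _ = X + _]vhom_mulE [X in _ = _ + X]vhom_mulE.
have -> : (fun y => vhom_mul (f y) (g y) i l (vpos a b) (vpos a' b')) =
    (fun y => f y i j a a' * g y j l b b').
  by apply/funext => y; exact: vhom_mulE.
by rewrite (cpartialM k oV (sf i j a a') (sg j l b b') Vx cx) 2!mxE.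
Qed.

Lemma vhom_mulNl (f : vhom R[i] E E) (g : vhom R[i] F F) i l :
  vhom_mul (fun i j => - f i j) g i l = - vhom_mul f g i l.
Proof.
apply/matrixP => r s; case: (vposP r) => j a b; case: (vposP s) => j' a' b'.
rewrite [RHS]mxE; case: (eqVneq j j') => [jj|jj].
  by case: _ / jj in a' b' *; rewrite [LHS]vhom_mulE [X in _ = - X]vhom_mulE mxE mulNr.
by rewrite [LHS]vhom_mul_neq// [X in _ = - X]vhom_mul_neq// oppr0.
Qed.

Lemma vhom_mulNr (f : vhom R[i] E E) (g : vhom R[i] F F) i l :
  vhom_mul f (fun i j => - g i j) i l = - vhom_mul f g i l.
Proof.
apply/matrixP => r s; case: (vposP r) => j a b; case: (vposP s) => j' a' b'.
rewrite [RHS]mxE; case: (eqVneq j j') => [jj|jj].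
  by case: _ / jj in a' b' *; rewrite [LHS]vhom_mulE [X in _ = - X]vhom_mulE mxE mulrN.
by rewrite [LHS]vhom_mul_neq// [X in _ = - X]vhom_mul_neq// oppr0.
Qed.

Variables (U U' : set M) (Phi : M -> vhom R[i] E E) (Phi' : M -> vhom R[i] F F).
Hypothesis sPhi : forall i j, mxsmooth_on A U (fun x => Phi x i j).
Hypothesis uPhi : forall x, U x -> vunit (Phi x).
Hypothesis sPhi' : forall i j, mxsmooth_on A U' (fun x => Phi' x i j).
Hypothesis uPhi' : forall x, U' x -> vunit (Phi' x).

Let D i j := flat_conn (A := A) U (fun x => Phi x i j).
Let D' i j := flat_conn (A := A) U' (fun x => Phi' x i j).
Let omega c k x : vhom R[i] E E := fun i j => flat_form (fun x => Phi x i j) c k x.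
Let omega' c k x : vhom R[i] F F := fun i j => flat_form (fun x => Phi' x i j) c k x.

Definition product_form c k x i l : 'M[R[i]]_(vobj_mul E F i l) :=
  vhom_mul (omega c k x) (@vhom_id n R[i] F F) i l +
  vhom_mul (@vhom_id n R[i] E E) (omega' c k x) i l.

Lemma conn_mul_flat V i l s c x k :
  open V -> V `<=` U -> V `<=` U' -> mxsmooth_on A V s -> V x -> cdom c x ->
  conn_dsum (fun j => conn_tens (@D i j) (@D' j l)) s c x k =
  dmx c k s x + product_form c k x i l *m s x.
Proof.
move=> oV VU VU' sV Vx cx.
have ssub j : mxsmooth_on A V (fun y => submxcol (s y) j).
  move=> a z; apply: csmooth_on_eq oV _ (sV (tagnat.Rank j a) z) => y _.
  by rewrite mxE.
apply/mxcolP => j; rewrite mxcolK.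
rewrite (conn_tens_flat k _ _ _ _ oV VU VU' (ssub j) Vx cx)//; first last.
- by move=> y U'y; exact: uPhi'.
- by move=> y Uy; exact: uPhi.
rewrite submxcolD; congr (_ + _).
  apply/matrixP => a z; rewrite [LHS]mxE [RHS]mxE [RHS]mxE; congr (cpartial _ _ _ _).
  by apply/funext => y; rewrite mxE.
rewrite mulmxDl [product_form _ _ _ _ _ *m _]mulmxDl submxcolD.
rewrite [X in _ = X + _]submxcol_vhom_mul [X in _ = _ + X]submxcol_vhom_mul.
by rewrite (vhom_idE R[i] F j l) (vhom_idE R[i] E i j).
Qed.

(** This characterizes [product_form] as the form of the flat connection for which
    the product frame is parallel. *)
Lemma product_form_mul V c k x i l : open V -> V `<=` U -> V `<=` U' ->
  V x -> cdom c x ->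
  product_form c k x i l *m vhom_mul (Phi x) (Phi' x) i l =
  - dmx c k (fun y => vhom_mul (Phi y) (Phi' y) i l) x.
Proof.
move=> oV VU VU' Vx cx; have Ux := VU _ Vx; have U'x := VU' _ Vx.
have sV i' j' := mxsmooth_on_sub VU (@sPhi i' j').
have sV' i' j' := mxsmooth_on_sub VU' (@sPhi' i' j').
rewrite mulmxDl (dmx_vhom_mul k i l oV sV sV' Vx cx) opprD.
rewrite -vhom_mulNl -vhom_mulNr; congr (_ + _).
  rewrite -[LHS]/(vhom_comp _ _ i l) -vhom_mul_comp vhom_id_comp.
  congr (vhom_mul _ _ i l); apply: vhomP => i' j'.
  exact: (flat_form_mul (fun y Uy => @uPhi y Uy i' j')).
rewrite -[LHS]/(vhom_comp _ _ i l) -vhom_mul_comp vhom_id_comp.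
congr (vhom_mul _ _ i l); apply: vhomP => i' j'.
exact: (flat_form_mul (fun y U'y => @uPhi' y U'y i' j')).
Qed.

End Product.

Section Compatibility.
Variables (n : nat) (E F G : vobj n).
Variables (U1 U2 U3 : set M) (Phi : M -> vhom R[i] E E)
  (Phi' : M -> vhom R[i] F F) (Phi'' : M -> vhom R[i] G G).
Hypothesis sPhi : forall i j, mxsmooth_on A U1 (fun x => Phi x i j).
Hypothesis uPhi : forall x, U1 x -> vunit (Phi x).
Hypothesis sPhi' : forall i j, mxsmooth_on A U2 (fun x => Phi' x i j).
Hypothesis uPhi' : forall x, U2 x -> vunit (Phi' x).
Hypothesis sPhi'' : forall i j, mxsmooth_on A U3 (fun x => Phi'' x i j).
Hypothesis uPhi'' : forall x, U3 x -> vunit (Phi'' x).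

(** Both sides are connections on the product for which the product frame
    [Phi . Phi'] is parallel: the right-hand side by [product_form_mul], and the
    pullback because [phi] maps this frame to [Phi'' P], with [P] constant. *)
Lemma conn_pull_flat U (phi : M -> vhom R[i] (vobj_mul E F) G) P i l :
  open U -> U `<=` U1 -> U `<=` U2 -> U `<=` U3 ->
  (forall i j, mxsmooth_on A U (fun x => phi x i j)) ->
  (forall x, U x -> vhom_iso (phi x)) ->
  (forall x, U x -> vhom_comp (phi x) (vhom_mul (Phi x) (Phi' x)) =
                    vhom_comp (Phi'' x) P) ->
  conn_eq U
    (conn_pull (fun x => phi x i l) (flat_conn (A := A) U3 (fun x => Phi'' x i l)))
    (conn_dsum (fun j => conn_tens (flat_conn (A := A) U1 (fun x => Phi x i j))
                                   (flat_conn (A := A) U2 (fun x => Phi' x j l)))).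
Proof.
move=> oU UU1 UU2 UU3 sphi iphi E_phi V s oV VU sV c x k Vx cx.
have Ux := VU _ Vx; have U3x := UU3 _ Ux; have VU3 := subset_trans VU UU3.
rewrite (conn_mul_flat sPhi uPhi sPhi' uPhi' k oV (subset_trans VU UU1)
  (subset_trans VU UU2) sV Vx cx) /conn_pull.
have sphiV := mxsmooth_on_sub VU (@sphi i l).
rewrite (flat_formE (@sPhi'' i l) (fun y Uy => @uPhi'' y Uy i l) k oV VU3
  (mxsmooth_onM oV sphiV sV) Vx cx).
rewrite (dmxM k oV sphiV sV Vx cx).
set Om := product_form _ _ _ _ _ _ _; set om := flat_form _ _ _ _.
have /andP[_ phi_full] := iphi x Ux i l.
(* [key] says that [phi] intertwines the connection forms [Om] and [om]. *)
suff key : dmx c k (fun y => phi y i l) x + om *m phi x i l = phi x i l *m Om.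
  rewrite addrAC (mulmxA om) -mulmxDl key -(mulmxA (phi x i l)) -mulmxDr.
  by rewrite mulmxA mulVpmx// mul1mx addrC.
pose Psi y := vhom_mul (Phi y) (Phi' y) i l.
have uPsi : Psi x \in unitmx.
  by apply: vunit_mul; [exact/uPhi/UU1|exact/uPhi'/UU2].
have sPsi : mxsmooth_on A U Psi.
  apply: mxsmooth_vhom_mul => // i' j'.
    exact: mxsmooth_on_sub UU1 (@sPhi i' j').
  exact: mxsmooth_on_sub UU2 (@sPhi' i' j').
have sPhiU := mxsmooth_on_sub UU3 (@sPhi'' i l).
(* After multiplication by the invertible product frame, [key] is the derivative of
   the equation [EU]. *)
apply: (can_inj (mulmxK uPsi)).
rewrite -mulmxA (product_form_mul sPhi uPhi sPhi' uPhi' k i l oU UU1 UU2 Ux cx) mulmxN -/Psi.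
have EU y : U y -> phi y i l *m Psi y = Phi'' y i l *m P i l.
  by move=> /E_phi/(congr1 (fun h => h i l)).
rewrite mulmxDl -mulmxA EU// mulmxA (flat_form_mul (fun y Uy => @uPhi'' y Uy i l)) //.
have := dmx_eq k oU Ux cx EU.
rewrite (dmxM k oU (@sphi i l) sPsi Ux cx).
rewrite (dmxM k oU sPhiU (mxsmooth_on_cst A U (P i l)) Ux cx) dmx_cst mulmx0 addr0.
by rewrite mulNmx => <-; rewrite opprD addrA subrr add0r.
Qed.

End Compatibility.

End FlatProduct.

(** * Gluing connections *)

Section Linearity.
Context {R : realType} {d : nat} {M : topologicalType}.
Variable A : smooth_atlas R d M.
Variables (I : Type) (r : seq I) (w : I -> R[i]).
Implicit Types (c : chart A) (x : M) (k : 'I_d).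

Lemma conn_tens_comb p q (D_ : I -> cov_op A p) (D'_ : I -> cov_op A q)
    (D : cov_op A p) (D' : cov_op A q) c x k :
  (forall s, D s c x k = \sum_(l <- r) w l *: D_ l s c x k) ->
  (forall s, D' s c x k = \sum_(l <- r) w l *: D'_ l s c x k) ->
  forall s, conn_tens D D' s c x k =
            \sum_(l <- r) w l *: conn_tens (D_ l) (D'_ l) s c x k.
Proof.
move=> ED ED' s; rewrite /conn_tens.
under [RHS]eq_bigr do rewrite scaler_sumr.
rewrite exchange_big; apply: eq_bigr => b _; apply/matrixP => t z.
rewrite (ord1 z); case: (mxtens_indexP t) => a b' {t z}.
rewrite mxE !tens_cvE ED ED' !summxE mulr_suml mulr_sumr -big_split /=.
apply: eq_bigr => l _; rewrite !mxE !mxtens_indexK !ord1 /=; ring.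
Qed.

Lemma conn_dsum_comb n (p : 'I_n -> nat) (D_ : I -> forall j, cov_op A (p j))
    (D : forall j, cov_op A (p j)) c x k :
  (forall j s, D j s c x k = \sum_(l <- r) w l *: D_ l j s c x k) ->
  forall s, conn_dsum D s c x k = \sum_(l <- r) w l *: conn_dsum (D_ l) s c x k.
Proof.
move=> ED s; apply/matrixP => t z; rewrite mxE ED !summxE.
by apply: eq_bigr => l _; rewrite !mxE.
Qed.

Lemma conn_pull_comb p q (phi : M -> 'M[R[i]]_(q, p)) (D_ : I -> cov_op A q)
    (D : cov_op A q) c x k :
  (forall s, D s c x k = \sum_(l <- r) w l *: D_ l s c x k) ->
  forall s, conn_pull phi D s c x k = \sum_(l <- r) w l *: conn_pull phi (D_ l) s c x k.
Proof.
move=> ED s; rewrite /conn_pull ED mulmx_sumr.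
by apply: eq_bigr => l _; rewrite scalemxAr.
Qed.

End Linearity.

Section GlueConnection.
Context {R : realType} {d : nat} {M : topologicalType}.
Variable A : smooth_atlas R d M.
Variables (I : Type) (W : I -> set M) (rho : I -> M -> R).
Hypothesis W_open : forall l, open (W l).
Hypothesis rho_smooth : forall l, smooth_on A setT (rho l).
Hypothesis rho_supp : forall l, closure [set x | rho l x != 0] `<=` W l.

Lemma rho_supp_mem l x : rho l x != 0 -> W l x.
Proof. by move=> rx; apply: rho_supp; exact: subset_closure. Qed.

(** The family [rho] itself may be infinite; [r] lists the indices that matter
    on [N]. *)
Definition locally_weighted (N : set M) (r : seq I) p (D_ : I -> cov_op A p)
    (D : cov_op A p) :=
  forall y c s k, N y -> D s c y k = \sum_(l <- r) (rho l y)%:C *: D_ l s c y k.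

(** Outside [W l] the weighted function vanishes near every point, by the
    hypothesis on the closure of the support of [rho l]. *)
Lemma smooth_weighted p V (F : I -> M -> 'cV[R[i]]_p) l : open V ->
  mxsmooth_on A (V `&` W l) (F l) -> mxsmooth_on A V (fun y => (rho l y)%:C *: F l y).
Proof.
move=> oV sF; apply: mxsmooth_on_local => x Vx.
have [Wx|nWx] := pselect (W l x).
  exists (V `&` W l) => //; apply: mxsmooth_onZ => //; first exact: openI.
  by apply: csmooth_on_real; exact: smooth_on_sub (@subsetT _ _) (rho_smooth l).
exists (V `&` ~` closure [set x | rho l x != 0]); first by split=> // /rho_supp.
have oVC : open (V `&` ~` closure [set x | rho l x != 0]).
  by apply: openI => //; apply: closed_openC; exact: closed_closure.
apply: (@mxsmooth_on_eq _ _ _ _ _ _ _ (fun=> 0)) => //; last exact: mxsmooth_on_cst.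
move=> y [_ ny]; have -> : rho l y = 0; last by rewrite scale0r.
by apply/eqP; apply: contrapT => /negP ry; apply: ny; exact: subset_closure.
Qed.

(** The condition that the weights have sum [1] is what the Leibniz rule needs:
    the terms [rho_l df s] add up to [df s]. Points where [rho l] vanishes
    contribute nothing, so that [D_ l] matters only over [W l]. *)
Lemma glue_connection p U (D_ : I -> cov_op A p) (D : cov_op A p) : open U ->
  (forall l, connection (W l `&` U) (D_ l)) ->
  (forall x, exists N r, [/\ open N, N x,
     forall y, N y -> \sum_(l <- r) rho l y = 1 & locally_weighted N r D_ D]) ->
  connection U D.
Proof.
move=> oU cD_ ND.
have VW l V : open V -> V `<=` U -> open (V `&` W l) /\ V `&` W l `<=` W l `&` U.
  by move=> oV VU; split; [exact: openI|move=> y [/VU]].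
split.
- move=> V s oV VU sV.
  have sform l : smooth_form (V `&` W l) (D_ l s).
    have [oVW VWU] := VW l V oV VU; have [h _ _ _] := cD_ l; apply: h => //.
    by apply: mxsmooth_on_sub sV; exact: subIsetl.
  split=> [c k|c c' x k Vx cx c'x].
    have oVc : open (V `&` cdom c) by apply: openI => //; exact: cdom_open.
    apply: mxsmooth_on_local => x [Vx cx]; have [N [r [oN Nx _ E]]] := ND x.
    exists (V `&` cdom c `&` N) => //.
    apply: (@mxsmooth_on_eq _ _ _ _ _ _ _
      (fun y => \sum_(l <- r) (rho l y)%:C *: D_ l s c y k)).
    + exact: openI.
    + by move=> y [_ Ny]; rewrite -E.
    apply: mxsmooth_on_sum; first exact: openI.
    move=> l; apply: (@mxsmooth_on_sub _ _ _ _ _ _ (V `&` cdom c)); first exact: subIsetl.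
    apply: (@smooth_weighted _ _ (fun l y => D_ l s c y k)) => //.
    have [h _] := sform l; apply: mxsmooth_on_sub (h c k).
    by move=> y [[Vy cy] Wy].
  have [N [r [oN Nx _ E]]] := ND x.
  rewrite E//; under [RHS]eq_bigr do rewrite E// scaler_sumr.
  rewrite exchange_big; apply: eq_bigr => l _ /=.
  under [RHS]eq_bigr do rewrite scalerA mulrC -scalerA.
  rewrite -scaler_sumr; have [rx|/rho_supp_mem Wx] := eqVneq (rho l x) 0.
    by rewrite rx !scale0r.
  by congr (_ *: _); have [_ h] := sform l; apply: h.
- move=> V s t oV VU sV tV c x k Vx cx; have [N [r [oN Nx _ E]]] := ND x.
  rewrite !E// -big_split /=; apply: eq_bigr => l _.
  have [rx|/rho_supp_mem Wx] := eqVneq (rho l x) 0; first by rewrite rx !scale0r addr0.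
  rewrite -scalerDr; congr (_ *: _).
  have [oVW VWU] := VW l V oV VU; have [_ h _ _] := cD_ l.
  by apply: (h (V `&` W l)) => //; apply: mxsmooth_on_sub (@subIsetl _ _ _) _.
- move=> V f s oV VU fV sV c x k Vx cx; have [N [r [oN Nx r1 E]]] := ND x.
  rewrite !E//.
  transitivity (\sum_(l <- r) (rho l x)%:C *:
      (cpartial c k f x *: s x + f x *: D_ l s c x k)).
    apply: eq_bigr => l _.
    have [rx|/rho_supp_mem Wx] := eqVneq (rho l x) 0; first by rewrite rx !scale0r.
    congr (_ *: _); have [oVW VWU] := VW l V oV VU; have [_ _ h _] := cD_ l.
    apply: (h (V `&` W l)) => //; first exact: csmooth_on_sub (@subIsetl _ _ _) fV.
    exact: mxsmooth_on_sub (@subIsetl _ _ _) sV.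
  under eq_bigr do rewrite scalerDr.
  rewrite big_split /= -scaler_suml -rmorph_sum /= r1// scale1r; congr (_ + _).
  rewrite scaler_sumr; apply: eq_bigr => l _.
  by rewrite !scalerA mulrC.
- move=> s c x k ngs; have [N [r [oN Nx _ E]]] := ND x.
  rewrite E// big1// => l _; have [_ _ _ h] := cD_ l; rewrite h ?scaler0//.
  move=> [cx [V [oV Vx VWU sV]]]; apply: ngs; split=> //; exists V; split=> //.
  by move=> y /VWU[].
Qed.

End GlueConnection.

(** * Connective structures *)

(** Decreasing order, as [chain_frames] adds the top element of a chain last. *)
Lemma chain_of_total disp (J : porderType disp) (s : seq J) :
  {in s &, total <=%O} -> exists2 t, t =i s & pairwise >%O t.
Proof.
move=> ts; pose t := rev (sort <=%O (undup s)).
have tE : t =i s by move=> a; rewrite mem_rev mem_sort mem_undup.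
exists t => //.
have lt_t : sorted <%O (sort <=%O (undup s)).
  rewrite lt_sorted_uniq_le sort_uniq undup_uniq.
  apply: (@sort_sorted_in _ (mem s)) => //.
  by apply/allP => a; rewrite mem_undup.
rewrite -sorted_pairwise; first by rewrite rev_sorted.
by move=> b a c ba cb; exact: lt_trans cb ba.
Qed.

Section ConnectiveStructures.
Context {R : realType} {d : nat} {M : topologicalType}.
Variables (A : smooth_atlas R d M) (n : nat).
Context {disp : Order.disp_t} {J : porderType disp}.
Implicit Types E : charted_2vb A n J.

Lemma cov_open E a : open (cov E a).
Proof. by have [h _] := cov_cover E; exact: h. Qed.

(** A connective structure on the restriction of [E] to the open set [W]. *)
Definition local_connective E (W : set M) (D : conn_family E) :=
  (forall a b (ab : (a < b)%O) i j,
     connection (W `&` (cov E a `&` cov E b)) (@D a b ab i j)) /\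
  (forall a b c (ab : (a < b)%O) (bc : (b < c)%O) (ac : (a < c)%O) i k,
     conn_eq (W `&` (cov E a `&` cov E b `&` cov E c))
       (conn_pull (fun x => coh E a b c x i k) (@D a c ac i k))
       (@conn_mul _ _ _ A n _ _ (@D a b ab) (@D b c bc) i k)).

Lemma local_connectiveT E (D : conn_family E) :
  connective_structure D <-> local_connective setT D.
Proof.
split=> -[D1 D2]; split => *; by [rewrite setTI; exact: D1 | rewrite setTI; exact: D2
 | rewrite -[X in connection X]setTI; exact: D1 | rewrite -[X in conn_eq X]setTI; exact: D2].
Qed.

(** The axioms of a connection are stable under combinations by
    [glue_connection]. Tensor products, direct sums and pullbacks commute with
    combinations of the values at a point ([conn_tens_comb] and its companions),
    so that the compatibility with the coherency maps is stable too. *)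
Lemma glue_connective E (I : Type) (W : I -> set M) (rho : I -> M -> R)
    (D_ : I -> conn_family E) (D : conn_family E) :
  (forall l, open (W l)) -> (forall l, smooth_on A setT (rho l)) ->
  (forall l, closure [set x | rho l x != 0] `<=` W l) ->
  (forall x, exists N r, [/\ open N, N x,
     forall y, N y -> \sum_(l <- r) rho l y = 1
   & forall a b (ab : (a < b)%O) i j,
       locally_weighted rho N r (fun l => @D_ l a b ab i j) (@D a b ab i j)]) ->
  (forall l, local_connective (W l) (D_ l)) -> connective_structure D.
Proof.
move=> oW srho Wrho ND locD; split=> [a b ab i j|a b c ab bc ac i k].
  apply: (@glue_connection _ _ _ _ _ W rho oW srho Wrho _ _
            (fun l => @D_ l a b ab i j)).
  - by apply: openI; exact: cov_open.
  - by move=> l; have [h _] := locD l.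
  - by move=> x; have [N [r [oN Nx r1 E']]] := ND x; exists N, r; split=> //; exact: E'.
move=> V s oV VU sV ch x kk Vx cx; have [N [r [oN Nx _ HD]]] := ND x.
have comb a' b' (ab' : (a' < b')%O) i' j' s' :
    @D a' b' ab' i' j' s' ch x kk =
    \sum_(l <- r) (rho l x)%:C *: @D_ l a' b' ab' i' j' s' ch x kk.
  exact: HD.
rewrite /conn_mul (conn_pull_comb (w := fun l => (rho l x)%:C) (r := r)
  (D_ := fun l => @D_ l a c ac i k) _ (comb a c ac i k)).
rewrite (conn_dsum_comb (w := fun l => (rho l x)%:C) (r := r)
  (D_ := fun l j => conn_tens (@D_ l a b ab i j) (@D_ l b c bc j k))); last first.
  by move=> j; apply: conn_tens_comb; exact: comb.
apply: eq_bigr => l _.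
have [rx|rx] := eqVneq (rho l x) 0; first by rewrite rx !scale0r.
have Wx : W l x by apply: Wrho; exact: subset_closure.
congr (_ *: _); have [_ h] := locD l.
apply: (h a b c ab bc ac i k (V `&` W l)) => //; first exact: openI.
  by move=> y [/VU].
exact: mxsmooth_on_sub (@subIsetl _ _ _) sV.
Qed.

Section Restriction.
Variables (E : charted_2vb A n J) (U : J -> set M).
Hypothesis U_cover : open_cover U.
Hypothesis U_sub : forall a, U a `<=` cov E a.

Let U3_sub a b c : U a `&` U b `&` U c `<=` cov E a `&` cov E b `&` cov E c.
Proof. by move=> x [[Ua Ub] Uc]; split; [split|]; exact: U_sub. Qed.

Lemma restrict_total (s : seq J) :
  (exists x, forall a, a \in s -> U a x) -> {in s &, total <=%O}.
Proof. by move=> [x sx]; apply: (@cov_total _ _ _ _ _ _ _ E); exists x => a /sx; exact: U_sub. Qed.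

Lemma restrict_iso a b c x : (a < b)%O -> (b < c)%O ->
  (U a `&` U b `&` U c) x -> vhom_iso (coh E a b c x).
Proof. by move=> ab bc /U3_sub; exact: coh_iso. Qed.

Lemma restrict_smooth a b c i k : (a < b)%O -> (b < c)%O ->
  mxsmooth_on A (U a `&` U b `&` U c) (fun x => coh E a b c x i k).
Proof. by move=> ab bc; apply: mxsmooth_on_sub (@U3_sub a b c) _; exact: coh_smooth. Qed.

Lemma restrict_assoc a b c e x i l : (a < b)%O -> (b < c)%O -> (c < e)%O ->
  (U a `&` U b `&` U c `&` U e) x ->
  vhom_comp (coh E a b e x)
    (vhom_mul (vhom_id R[i] (obj E a b) (obj E a b)) (coh E b c e x)) i l =
  vhom_comp (coh E a c e x)
    (vhom_comp
      (vhom_mul (coh E a b c x) (vhom_id R[i] (obj E c e) (obj E c e)))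
      (vassoc R[i] (obj E a b) (obj E b c) (obj E c e))) i l.
Proof.
move=> ab bc ce [U3 Ue]; apply: coh_assoc => //.
by split; [exact: U3_sub|exact: U_sub].
Qed.

Definition restrict_2vb : charted_2vb A n J :=
  Charted2VB U_cover restrict_total (@obj_gl _ _ _ _ _ _ _ E)
    (@obj_mul _ _ _ _ _ _ _ E) restrict_iso restrict_smooth restrict_assoc.

Lemma restrict_refinement : elementary_refinement E id restrict_2vb.
Proof.
split=> // [a b ab|a b c x i k ab bc _].
  by rewrite (lt_eqF ab).
by rewrite (lt_eqF ab) (lt_eqF bc) /= conform_mx_id.
Qed.

(** Near a given point [x], only the [U a] whose closure contains [x] matter. As
    these closures lie in the sets [cov E a], all coherency maps are defined on a
    whole neighbourhood of [x], over which [chain_frames] applies. *)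
Lemma local_connective_exists :
  (forall a, closure (U a) `<=` cov E a) ->
  locally_finite (fun a => closure (U a)) ->
  forall x, exists W (D : conn_family restrict_2vb),
    [/\ open W, W x & local_connective W D].
Proof.
move=> clU lfU x; have [N [Nx finN]] := lfU x.
have /finite_seqP[s sE] := finN.
pose sx := [seq a <- s | `[< closure (U a) x >]].
(* Near [x], the indices in [sx] still have their sets [cov E a] around the point,
   and the finitely many other indices of [s] have disappeared. *)
have near_s : \forall y \near x, forall a, a \in s ->
    (closure (U a) x -> cov E a y) /\ (~ closure (U a) x -> ~ closure (U a) y).
  elim: s {sx sE} => [|a s IH]; first by near=> y.
  have ha : \forall y \near x,
      (closure (U a) x -> cov E a y) /\ (~ closure (U a) x -> ~ closure (U a) y).
    have [ax|ax] := pselect (closure (U a) x).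
      have : \forall y \near x, cov E a y.
        by apply: open_nbhs_nbhs; split; [exact: cov_open|exact: clU].
      by apply: filterS.
    have : \forall y \near x, ~ closure (U a) y.
      apply: open_nbhs_nbhs; split=> //.
      by apply: closed_openC; exact: closed_closure.
    by apply: filterS.
  apply: filterS2 ha IH => y hay IHy b.
  by rewrite inE => /orP[/eqP->//|/IHy].
pose B := N `&` [set y | forall a, a \in s ->
    (closure (U a) x -> cov E a y) /\ (~ closure (U a) x -> ~ closure (U a) y)].
have Bx : nbhs x B by exact: filterI.
pose W := interior B.
have oW : open W by exact: open_interior.
have Wx : W x by exact: Bx.
have WN : W `<=` B by exact: interior_subset.
have sxE a y : W y -> U a y -> a \in sx.
  move=> Wy Uy; have [Ny sy] := WN _ Wy.
  have as_ : a \in s.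
    have : [set` s] a by rewrite -sE; exists y; split=> //; exact: subset_closure.
    by [].
  rewrite mem_filter as_ andbT; apply/asboolP; apply: contrapT => /(sy _ as_).2.
  by apply; exact: subset_closure.
have Wsx a : a \in sx -> W `<=` cov E a.
  rewrite mem_filter => /andP[/asboolP ax as_] y /WN[_ /(_ _ as_)[h _]].
  exact: h.
have [t tE tchain] : exists2 t, t =i sx & pairwise >%O t.
  apply: chain_of_total; apply: (@cov_total _ _ _ _ _ _ _ E).
  by exists x => a asx; exact: Wsx.
have Wt a : a \in t -> W `<=` cov E a by rewrite tE; exact: Wsx.
have [Phi [sPhi uPhi cPhi]] := chain_frames oW tchain Wt.
have tU a y : W y -> U a y -> a \in t by rewrite tE; exact: sxE.
have sPhiU a b (ab : (a < b)%O) i j :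
    mxsmooth_on A (W `&` (U a `&` U b)) (fun y => Phi a b y i j).
  apply: mxsmooth_on_local => y [Wy [Ua Ub]]; exists W => //.
  exact: (sPhi a b (tU _ _ Wy Ua) (tU _ _ Wy Ub) ab).
have uPhiU a b (ab : (a < b)%O) y : (W `&` (U a `&` U b)) y -> vunit (Phi a b y).
  by move=> [Wy [Ua Ub]]; exact: (uPhi a b (tU _ _ Wy Ua) (tU _ _ Wy Ub) ab).
exists W, (fun a b ab i j => flat_conn (A := A) (W `&` (U a `&` U b))
                               (fun y => Phi a b y i j)).
split=> //; split=> [a b ab i j|a b c ab bc ac i k].
  by apply: flat_connection => [|y Wy]; [exact: sPhiU|exact: uPhiU].
move=> V r oV VU rV ch y kk Vy cy.
have oU a' : open (U a') by have [h _] := U_cover; exact: h.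
have [Wy [[Ua Ub] Uc]] := VU _ Vy.
have [P HP] := cPhi a b c (tU _ _ Wy Ua) (tU _ _ Wy Ub) (tU _ _ Wy Uc) ab bc.
have oV3 : open (W `&` (U a `&` U b `&` U c)) by repeat apply: openI.
have s1 : W `&` (U a `&` U b `&` U c) `<=` W `&` (U a `&` U b).
  by move=> z [Wz [[? ?] ?]].
have s2 : W `&` (U a `&` U b `&` U c) `<=` W `&` (U b `&` U c).
  by move=> z [Wz [[? ?] ?]].
have s3 : W `&` (U a `&` U b `&` U c) `<=` W `&` (U a `&` U c).
  by move=> z [Wz [[? ?] ?]].
have sphi i' j' : mxsmooth_on A (W `&` (U a `&` U b `&` U c))
    (fun z => coh E a b c z i' j').
  by apply: (mxsmooth_on_sub _ (@restrict_smooth a b c i' j' ab bc)) => z [].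
have iphi z : (W `&` (U a `&` U b `&` U c)) z -> vhom_iso (coh E a b c z).
  by move=> [_]; exact: restrict_iso.
have HPU z : (W `&` (U a `&` U b `&` U c)) z ->
    vhom_comp (coh E a b c z) (vhom_mul (Phi a b z) (Phi b c z)) =
    vhom_comp (Phi a c z) P.
  by move=> [Wz _]; exact: HP.
have H := @conn_pull_flat _ _ _ A _ _ _ _ _ _ _ _ _ _ (sPhiU _ _ ab) (uPhiU _ _ ab)
  (sPhiU _ _ bc) (uPhiU _ _ bc) (sPhiU _ _ ac) (uPhiU _ _ ac)
  _ _ _ i k oV3 s1 s2 s3 sphi iphi HPU.
exact: (H V r oV VU rV ch y kk Vy cy).
Unshelve. all: by end_near. Qed.

End Restriction.

End ConnectiveStructures.

(** * The space of connective structures *)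

Section Segment.
Context {R : realType} {d : nat}.
Implicit Types (O : set 'rV[R]_d) (f g : 'rV[R]_d -> R).

Lemma pderivs_comb O f g (a b : R) ks y : open O -> Cinfty O f -> Cinfty O g -> O y ->
  pderivs ks (fun z => a * f z + b * g z) y = a * pderivs ks f y + b * pderivs ks g y.
Proof.
move=> oO Of Og; elim: ks y => [//|k ks IH] y Oy /=.
have [_ df] := Of ks y Oy; have [_ dg] := Og ks y Oy.
rewrite (@near_eq_derive _ _ _ _
  (fun z => a *: pderivs ks f z + b *: pderivs ks g z)); last first.
  by apply: (near_open_eq oO) => // z /set_mem Oz; exact: IH.
have da : derivable (fun z => a *: pderivs ks f z) y (delta_mx 0 k).
  exact: derivableZ (df k).
have db : derivable (fun z => b *: pderivs ks g z) y (delta_mx 0 k).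
  exact: derivableZ (dg k).
by rewrite [LHS](deriveD da db) [X in X + _](deriveZ a (df k)) [X in _ + X](deriveZ b (dg k)).
Qed.

Lemma compact_bound (K : set 'rV[R]_d) f : compact K ->
  (forall y, K y -> {for y, continuous f}) ->
  exists2 B, 0 <= B & forall y, K y -> `|f y| <= B.
Proof.
move=> cK cf; have [->|/set0P K0] := eqVneq K set0; first by exists 0.
have [|c Kc cmax] := @compact_EVT_max _ R (fun y => `|f y|) K K0 cK.
  apply: continuous_in_subspaceT => y /set_mem Ky.
  by apply: for_continuous_norm; exact: cf.
by exists `|f c| => // y Ky; apply: cmax; rewrite inE.
Qed.

End Segment.

Section Contractibility.
Context {R : realType} {d : nat} {M : topologicalType}.
Variables (A : smooth_atlas R d M) (n : nat).
Context {disp : Order.disp_t} {J : porderType disp}.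
Variable E : charted_2vb A n J.
Implicit Types (D : conn_space E) (u : jet_index E).

Lemma uniform_family_near (T : choiceType) (V : uniformType) (fam : set T -> Prop)
    (f : {family fam, T -> V}) K (e : set (V * V)) : fam K -> entourage e ->
  \forall g \near f, forall y, K y -> e (f y, g y).
Proof.
move=> famK ee; have FF : Filter (nbhs f) by exact: nbhs_filter.
have h := (@fam_cvgP _ _ fam (nbhs f) f FF).1 cvg_id K famK; apply: h.
by apply: (uniform_nbhs (f : {uniform` K -> V}) _).2; exists e; split=> // g.
Qed.

(** This and [jet_cvg] unfold the initial topology, in one direction each: a
    neighbourhood of [D] is controlled by finitely many estimates on compact
    sets. *)
Lemma jet_near D u K (e : R) : jet_compacts u K -> 0 < e ->
  \forall D' \near D, forall y, K y -> `|jet D u y - jet D' u y| < e.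
Proof.
move=> uK e0.
have h : \forall g \near (jet D u : {family (jet_compacts u), 'rV[R]_d -> R}),
    forall y, K y -> `|jet D u y - g y| < e.
  apply: (uniform_family_near (e := [set xy | `|xy.1 - xy.2| < e]) _ uK).
  by rewrite -entourage_ballE; exists e => //= -[x y]; rewrite -ball_normE.
have c1 := @initial_continuous _ _ (@jet _ _ _ _ _ _ _ E) D.
have c2 : nbhs (jet D) --> (jet D : initial_topology (fun g : prod_topology
    (fun u : jet_index E => {family (jet_compacts u), 'rV[R]_d -> R}) => g u)).
  by have /cvg_sup/(_ u) : nbhs (jet D) --> jet D by exact: cvg_id.
have c3 := @initial_continuous _ _ (fun g : prod_topology (fun u : jet_index E =>
  {family (jet_compacts u), 'rV[R]_d -> R}) => g u) (jet D).
exact: c1 (c2 _ (c3 _ h)).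
Qed.

Lemma jet_cvg (T : Type) (F : set_system T) (FF : Filter F) (f : T -> conn_space E) D :
  (forall u K (e : R), jet_compacts u K -> 0 < e ->
     \forall p \near F, forall y, K y -> `|jet D u y - jet (f p) u y| < e) ->
  f @ F --> D.
Proof.
move=> H.
have cj : (fun p => jet (f p)) @ F --> jet D.
  apply/cvg_sup => u.
  move=> U [?/= [[B oB <-]]] /= Bf /filterS; apply.
  have Cu : (fun p => jet (f p) u) @ F -->
      (jet D u : {family (jet_compacts u), 'rV[R]_d -> R}).
    apply/fam_cvgP => K uK Q /uniform_nbhs[e [ee eQ]].
    move: ee; rewrite -entourage_ballE => -[r /= r0 re].
    have := H u K r uK r0; apply: filterS => p hp; apply: eQ => y Ky.
    by apply: re; rewrite -ball_normE /=; exact: hp.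
  by apply: Cu; exact: open_nbhs_nbhs.
move=> U [?/= [[B oB <-]]] /= Bf /filterS; apply; apply: cj.
exact: open_nbhs_nbhs.
Qed.

Definition jet_coefficient D u (y : 'rV[R]_d) : R :=
  let z := D _ _ (jlt u) (ji u) (jj u) (cst (delta_mx (jcol u) 0))
             (jchart u) (cinv (jchart u) y) (jdir u) (jrow u) 0 in
  if jre u then complex.Re z else complex.Im z.

Definition jet_domain u : set 'rV[R]_d :=
  cmap (jchart u) @` (cov E (jsrc u) `&` cov E (jtgt u) `&` cdom (jchart u)).

Lemma jet_domain_open u : open (jet_domain u).
Proof. by apply: chart_image_open; apply: openI; exact: cov_open. Qed.

Lemma jet_coefficient_smooth D u : connective_structure D ->
  Cinfty (jet_domain u) (jet_coefficient D u).
Proof.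
move=> [cD _]; have [h _ _ _] := cD _ _ (jlt u) (ji u) (jj u).
have oU : open (cov E (jsrc u) `&` cov E (jtgt u)) by apply: openI; exact: cov_open.
have [{}h _] := h _ _ oU (@subset_refl _ _) (mxsmooth_on_cst A _ (delta_mx (jcol u) 0)).
have [hr hi] := h (jchart u) (jdir u) (jrow u) 0.
have sub : jet_domain u `<=` cmap (jchart u) @`
   (cov E (jsrc u) `&` cov E (jtgt u) `&` cdom (jchart u) `&` cdom (jchart u)).
  by move=> _ [x [Ux cx] <-]; exists x.
rewrite /jet_coefficient; case: (jre u) => ks y /sub yU.
  exact: hr (jchart u) ks y yU.
exact: hi (jchart u) ks y yU.
Qed.

Definition segment (D0 : conn_space E) (p : conn_space E * R) : conn_space E :=
  fun a b ab i j s c x k =>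
    (1 - p.2)%:C *: p.1 a b ab i j s c x k + p.2%:C *: D0 a b ab i j s c x k.

Lemma jet_segment D0 D u K t y : connective_structure D0 -> connective_structure D ->
  jet_compacts u K -> K y ->
  jet (segment D0 (D, t)) u y = (1 - t) * jet D u y + t * jet D0 u y.
Proof.
move=> cD0 cD [_ KU] Ky; have Oy := KU _ Ky.
rewrite -(pderivs_comb _ _ _ (@jet_domain_open u) (@jet_coefficient_smooth D u cD)
  (@jet_coefficient_smooth D0 u cD0) Oy).
rewrite /jet; congr (pderivs _ _ _); apply/funext => z.
rewrite /jet_coefficient /segment /=; case: (jre u).
  by rewrite !mxE complex_ReD !complex_ReM /= !mul0r !subr0.
by rewrite !mxE complex_ImD !complex_ImM /= !mul0r !addr0.
Qed.

(** A combination of two connective structures over all of [M], with constant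
    weights. *)
Lemma segment_connective D0 D t : connective_structure D0 -> connective_structure D ->
  connective_structure (segment D0 (D, t)).
Proof.
move=> cD0 cD.
apply: (@glue_connective _ _ _ _ _ _ _ E bool (fun=> setT)
  (fun b => cst (if b then 1 - t else t)) (fun b => if b then D else D0)).
- by move=> _; exact: openT.
- by move=> b; exact: smooth_on_cst.
- by [].
- move=> x; exists setT, [:: true; false]; split=> //; first exact: openT.
    by move=> y _; rewrite big_cons big_seq1 /= subrK.
  by move=> a b ab i j y c s k _; rewrite big_cons big_seq1.
- by case; apply/local_connectiveT.
Qed.

(** The difference of the jets of two points [(D, t)] and [(D', t')] is
    [(1 - t') (D - D') - (t - t') (D - D0)]. Its first term is small with
    [D - D'], since [0 <= t' <= 1], and its second term with [t - t'], since the
    jet of [D - D0] is bounded on compact sets. *)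
Lemma segment_continuous D0 : connective_structure D0 ->
  {within [set D : conn_space E | connective_structure D] `*` `[0, 1],
   continuous (segment D0)}.
Proof.
move=> cD0; apply/subspace_continuousP => -[D t] [/= cD].
rewrite in_itv /= => /andP[t0 t1]; apply: jet_cvg => u K e uK e0.
have [cK KU] := uK.
have [B B0 fB] : exists2 B, 0 <= B & forall y, K y -> `|jet D u y - jet D0 u y| <= B.
  apply: compact_bound => // y /KU Oy.
  have [c1 _] := @jet_coefficient_smooth D u cD (jders u) y Oy.
  have [c2 _] := @jet_coefficient_smooth D0 u cD0 (jders u) y Oy.
  apply: for_continuousD c1 _; exact: (@continuousN _ _ _ _ _ c2).
have B1 : 0 < B + 1 by rewrite ltr_wpDl.
have nD : \forall p \near ((D, t) : conn_space E * R),
    forall y, K y -> `|jet D u y - jet p.1 u y| < e / 2.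
  have e2 : 0 < e / 2 by rewrite divr_gt0.
  exact: cvg_fst (jet_near D uK e2).
have nt : \forall p \near ((D, t) : conn_space E * R), `|t - p.2| < e / 2 / (B + 1).
  have h : \forall r \near t, `|t - r| < e / 2 / (B + 1).
    have d0 : 0 < e / 2 / (B + 1) by rewrite !divr_gt0.
    by have := nbhsx_ballx t _ d0; apply: filterS => r; rewrite -ball_normE.
  exact: cvg_snd h.
rewrite near_withinE; apply: filterS2 nD nt => -[D' t'] /= nD' nt' [/= cD'].
rewrite in_itv /= => /andP[t'0 t'1] y Ky.
rewrite (jet_segment _ cD0 cD uK Ky) (jet_segment _ cD0 cD' uK Ky).
rewrite [X in `|X|](_ : _ = (1 - t') * (jet D u y - jet D' u y)
  - (t - t') * (jet D u y - jet D0 u y)); last by ring.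
rewrite (le_lt_trans (ler_normB _ _))// !normrM [e]splitr.
have h1 : `|1 - t'| <= 1 by rewrite ger0_norm ?subr_ge0// lerBlDr lerDl.
apply: ltr_leD.
  rewrite (le_lt_trans (ler_wpM2r _ h1))// mul1r; exact: nD'.
rewrite (le_trans (ler_pM _ _ (ltW nt') (fB y Ky)))//.
by rewrite mulrAC ler_pdivrMr// ler_wpM2l ?divr_ge0 ?ltW// ltrDl.
Qed.

Lemma connective_contractible D0 : connective_structure D0 ->
  contractible R [set D : conn_space E | connective_structure D].
Proof.
move=> cD0; exists D0, (segment D0); split=> //.
- exact: segment_continuous.
- by move=> [D t] [/= cD _]; exact: segment_connective.
- move=> D _; rewrite /segment /= subr0.
  do 9 (apply: functional_extensionality_dep => ?).
  by rewrite scale1r scale0r addr0.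
- move=> D _; rewrite /segment /= subrr.
  do 9 (apply: functional_extensionality_dep => ?).
  by rewrite scale1r scale0r add0r.
Qed.

End Contractibility.

(** * Existence *)

Section Existence.
Context {R : realType} {d : nat} {M : topologicalType}.
Variables (A : smooth_atlas R d M) (n : nat).

(** Turns the finitely supported sums of a partition of unity into sums over one
    list of indices for a whole neighbourhood [N] of [x]. *)
Lemma fsum_locally_finite (I : choiceType) (rho : I -> M -> R) :
  locally_finite (fun l => closure [set x | rho l x != 0]) ->
  forall x, exists N r, [/\ open N, N x & forall (V : nmodType) (F : I -> V) y,
    N y -> (forall l, rho l y = 0 -> F l = 0) ->
    \sum_(l \in [set: I]) F l = \sum_(l <- r) F l].
Proof.
move=> lf x; have [N [Nx /finite_seqP[s sE]]] := lf x.
exists (interior N), (undup s); split=> //; first exact: open_interior.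
move=> V F y /interior_subset Ny F0.
rewrite [RHS]fsbig_seq ?undup_uniq//; apply/esym; apply: fsbig_widen => // l [_ /= ls].
apply: F0; apply/eqP; apply: contrapT => /negP ly; apply: ls; rewrite mem_undup.
have : [set` s] l by rewrite -sE; exists y; split=> //; exact: subset_closure.
by [].
Qed.

(** The partition of unity is indexed by the points of [M], each carrying its own
    neighbourhood and local connective structure. *)
Lemma connective_structure_exists disp (J : porderType disp) (E : charted_2vb A n J) :
  partitions_of_unity A ->
  (forall x, exists W (D : conn_family E), [/\ open W, W x & local_connective W D]) ->
  exists D : conn_family E, connective_structure D.
Proof.
move=> pou loc.
have /choice[W locW] := loc; have /choice[D_ locD] := locW.
have W_cover : open_cover W.
  by split=> x; [|exists x]; have [oW Wx _] := locD x.
have [rho [srho _ Wrho lfrho rho1]] := pou M W W_cover.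
exists (fun a b ab i j s c y k =>
  \sum_(x \in [set: M]) (rho x y)%:C *: D_ x a b ab i j s c y k).
apply: (@glue_connective _ _ _ _ _ _ _ E M W rho D_) => //.
- by move=> x; have [] := locD x.
- move=> x; have [N [r [oN Nx Nsum]]] := fsum_locally_finite lfrho x.
  exists N, r; split=> // [y Ny|a b ab i j y c s k Ny].
    by rewrite -(Nsum _ (fun l => rho l y) y Ny).
  by apply: (Nsum _ _ y Ny) => l ->; rewrite scale0r.
- by move=> x; have [] := locD x.
Qed.

End Existence.

Theorem lemma3p2 (R : realType) (d : nat) (M : topologicalType)
    (A : smooth_atlas R d M)
    (M_hausdorff : hausdorff_space M)
    (M_paracompact : paracompact M)
    (M_partitions : partitions_of_unity A)
    (n : nat) (disp : Order.disp_t) (J : porderType disp)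
    (E : charted_2vb A n J) :
  exists (disp' : Order.disp_t) (J' : porderType disp') (kappa : J' -> J)
         (E' : charted_2vb A n J'),
    [/\ elementary_refinement E kappa E',
        exists D : conn_space E', connective_structure D
      & contractible R [set D : conn_space E' | connective_structure D]].
Proof.
have [rho [srho _ Erho lfrho rho1]] := M_partitions J (cov E) (cov_cover E).
pose U a := [set x | rho a x != 0].
have U_cover : open_cover U.
  split=> [a|x].
    have -> : U a = rho a @^-1` [set r | r != 0] by [].
    apply: open_comp; last exact: open_neq.
    by move=> x _; exact: smooth_continuous.
  (* A point where every [rho a] vanishes would contradict that they have sum 1. *)
  apply: contrapT => /forallNP nU.
  have := rho1 x; rewrite fsbig1 => [/esym/eqP|a _]; first by rewrite oner_eq0.
  by apply/eqP; apply: contrapT => /negP; exact: nU.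
have U_sub a : U a `<=` cov E a by move=> x Ux; apply: Erho; exact: subset_closure.
pose E' := restrict_2vb U_cover U_sub.
have [D cD] : exists D : conn_family E', connective_structure D.
  by apply: connective_structure_exists => //; exact: local_connective_exists.
exists disp, J, id, E'; split.
- exact: restrict_refinement.
- by exists D.
- exact: connective_contractible cD.
Qed.
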